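(* Let $d\ge1$ be an integer and $n\in\mathbb{Z}$. Assume that the coupled system with $d$ second class particles is stationary and $\underline{\xi}\sim\underline{\nu}^n$. For a given $m\in\mathbb{Z}$, there is a second class particle at site $m$ with probability $$\mathbb{P}_{\underline{\nu}^n}(\xi_m>\eta_m)=(q;q)_\infty\left\{\sum_{k=(m-n-1)^+}^\infty\frac{q^{(k+1)(n-m+k+1)}}{(q;q)_k(q;q)_{n-m+k+1}}-\sum_{k=(m-n-d-1)^+}^\infty\frac{q^{(k+1)(n+d-m+k+1)}}{(q;q)_k(q;q)_{n+d-m+k+1}}\right\}.$$
   Context: Fix $q\in(0,1)$. $(x)^+=\max\{x,0\}$. $(q;q)_0=1$, $(q;q)_r=\prod_{i=1}^{r}(1-q^i)$, $(q;q)_\infty=\prod_{i=1}^\infty(1-q^i)$. For $c\in\mathbb{R}$, $\underline{\mu}^c$ is the product probability measure on $\{0,1\}^{\mathbb{Z}}$ under which the coordinates $z_i$ are independent with $\underline\mu^c(z_i=1)=\frac{q^{c-i}}{1+q^{c-i}}$. It is concentrated on the countable set $\Omega=\{\underline z\in\{0,1\}^{\mathbb{Z}}:\sum_{i\le0}z_i<\infty,\ \sum_{i\ge1}(1-z_i)<\infty\}$. For $\underline z\in\Omega$ let $N(\underline z)=\sum_{i=1}^\infty(1-z_i)-\sum_{i=-\infty}^0z_i$. For $n\in\mathbb{Z}$, $\underline\nu^n(\cdot)=\underline\mu^c(\,\cdot\mid N=n)$ (independent of $c$). ASEP: the Markov jump process $\underline\xi(t)$ on $\Omega$ in which, for every $i\in\mathbb{Z}$,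 a particle at $i$ jumps to $i+1$ at rate $1$ if $i+1$ is empty, and a particle at $i+1$ jumps to $i$ at rate $q$ if $i$ is empty. The label of a particle of $\underline\xi(t)$ is the number of particles of $\underline\xi(t)$ strictly to its left; labels are $0,1,2,\dots$. Coupled system with $d$ second class particles: let $Z_+^d=\{\underline x\in\mathbb{Z}^d:0\le x_1<\dots<x_d\}$. It is the Markov process $(\underline\xi(t),\underline x(t))$ on $\Omega\times Z_+^d$ in which $\underline\xi(t)$ evolves as ASEP, and the label process $\underline x(t)$ evolves as follows: each coordinate $x_j$ becomes $x_j+1$ at rate $q$ if $x_j+1$ is not one of the coordinates of $\underline x$, and becomes $x_j-1$ at rate $1$ if $x_j-1\ge0$ and $x_j-1$ is not one of the coordinates; in either case the move is allowed only if the two particles of $\underline\xi(t)$ whose labels are the old and new values of $x_j$ occupy neighbouring sites. Let $X_j(t)$ be the site of the particle of $\underline\xi(t)$ with label $x_j(t)$; $X_1(t)<\dots<X_d(t)$ are the positions of the second class particles. Put $\underline\eta(t)=\underline\xi(t)-\sum_{j=1}^d\underline\delta_{X_j(t)}$, where $\underline\delta_i$ is the configuration with a single particle, at site $i$. The coupled system is stationary if the law of $(\underline\xi(t),\underline x(t))$ does not depend on $t$; $\underline\xi,\underline\eta,\underline x,\underline X$ denote the values at a fixed time. $\mathbb{P}_{\underline\nu^n}$ denotes probability when the coupled system is stationary with $\underline\xi\sim\underline\nu^n$. *)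

(* Defs.v *)
From HB Require Import structures.
From mathcomp Require Import all_boot all_order all_algebra.
From mathcomp Require Import all_classical all_reals all_analysis.

Set Implicit Arguments.
Unset Strict Implicit.
Unset Printing Implicit Defensive.

Import Order.TTheory GRing.Theory Num.Theory.
Import numFieldNormedType.Exports.

Local Open Scope classical_set_scope.
Local Open Scope ring_scope.

(* (q;q)_r and (q;q)_oo *)
Definition qpoch (R : realType) (q : R) (r : nat) : R :=
  \prod_(1 <= i < r.+1) (1 - q ^+ i).

Definition qpoch_inf (R : realType) (q : R) : R :=
  limn (fun r => qpoch q r).

Definition posp (x : int) : nat := absz (Num.max x 0).

Definition config : Type := int -> bool.

Definition Omega : set config :=
  [set z : config | finite_set [set i : int | i <= 0 /\ z i] /\
           finite_set [set i : int | 1 <= i /\ ~~ z i]].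

(* [\sum_(i \in A) F i] is the sum over the finite support of F in A, and 0
   when that support is infinite; the supports are finite for z in Omega, here
   and in [label] below. *)
Definition height (z : config) : int :=
  \sum_(i \in [set i : int | 1 <= i]) ((~~ z i)%:R : int)
  - \sum_(i \in [set i : int | i <= 0]) ((z i)%:R : int).

Definition level (n : int) : set config := Omega `&` [set z : config | height z = n].

Definition cylinders : set (set config) :=
  [set A | exists (i : int) (b : bool), A = [set z : config | z i = b]].

(* {0,1}^Z with its product sigma-algebra *)
Definition config_space := g_sigma_algebraType cylinders.

Definition is_product_blocking (R : realType) (q c : R)
    (mu : probability config_space R) : Prop :=
  (forall i : int,
     mu [set z : config | z i = true]
     = (q `^ (c - i%:~R) / (1 + q `^ (c - i%:~R)))%:E) /\
  (forall (J : seq int) (b : int -> bool), uniq J ->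
     mu [set z : config | forall i, i \in J -> z i = b i]
     = (\prod_(i <- J) mu [set z : config | z i = b i])%E).

(* Conditional probability mu (A | N = n). *)
Definition blocking_cond (R : realType) (mu : probability config_space R)
    (n : int) (A : set config) : R :=
  fine (mu (A `&` level n)) / fine (mu (level n)).

Section MarkovJumpProcess.
Variables (R : realType) (S : choiceType) (rate : S -> S -> R).

(* Honest transition function p whose Q-matrix has off-diagonal entries
   [rate s s'] and diagonal entries [- \sum_(s' != s) rate s s']. *)
Definition transition_function (p : R -> S -> S -> R) : Prop :=
  [/\ forall t s s', 0 <= t -> 0 <= p t s s',
      forall t s, 0 <= t -> (\esum_(s' in [set: S]) (p t s s')%:E = 1)%E,
      forall s s', p 0 s s' = (s == s')%:R &
      forall t u s s', 0 <= t -> 0 <= u ->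
        ((p (t + u) s s')%:E
         = \esum_(r in [set: S]) (p t s r * p u r s')%:E)%E].

Definition has_rates (p : R -> S -> S -> R) : Prop :=
  (forall s s', s != s' -> h^-1 * p h s s' @[h --> 0^'+] --> rate s s') /\
  (forall s, (h^-1 * (1 - p h s s))%:E @[h --> 0^'+] -->
     (\esum_(s' in [set s' | s' != s]) (rate s s')%:E)%E).

(* On bounded time intervals f is a right-continuous step function with finitely
   many jumps: the jump times lie in D, and the value at a jump time is the one
   after the jump. *)
Definition step_path (f : R -> S) : Prop :=
  forall b : R, exists2 D : set R, finite_set D &
    forall s t, 0 <= s -> s <= t -> t <= b ->
      D `&` [set r | s < r <= t] = set0 -> f s = f t.

Definition markov_jump_process d (T : measurableType d) (P : probability T R)
    (Y : R -> T -> S) : Prop :=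
  [/\ forall t (A : set S), 0 <= t -> measurable (Y t @^-1` A),
      {ae P, forall w, step_path (Y ^~ w)} &
      exists p : R -> S -> S -> R,
        [/\ transition_function p, has_rates p &
        forall (k : nat) (r : 'I_k -> R) (v : 'I_k -> S) (t u : R) (s s' : S),
          (forall i, 0 <= r i <= t) -> 0 <= t -> 0 <= u ->
          (P ([set w | forall i, Y (r i) w = v i] `&`
              [set w | Y t w = s] `&` [set w | Y (t + u)%R w = s'])
           = P ([set w | forall i, Y (r i) w = v i] `&` [set w | Y t w = s])
             * (p u s s')%:E)%E]].

Definition stationary d (T : measurableType d) (P : probability T R)
    (Y : R -> T -> S) : Prop :=
  forall t (A : set S), 0 <= t -> P (Y t @^-1` A) = P (Y 0 @^-1` A).

End MarkovJumpProcess.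

Definition exchange (z : config) (i : int) : config :=
  fun k => if k == i then z (i + 1) else if k == i + 1 then z i else z k.

(* In the sums defining the rates, at most one summand is nonzero. *)
Definition asep_rate (R : realType) (q : R) (z z' : config) : R :=
  \sum_(i \in [set: int])
    (z' == exchange z i)%:R *
    ((z i && ~~ z (i + 1))%:R + q * (~~ z i && z (i + 1))%:R).

Definition label (z : config) (i : int) : int :=
  \sum_(k \in [set k : int | k < i]) ((z k)%:R : int).

(* Site of the particle with label a; every a >= 0 is the label of exactly one
   particle when z is in Omega. *)
Definition site (z : config) (a : int) : int :=
  xget 0 [set i : int | z i /\ label z i = a].

Definition Zplus (d : nat) : set {ffun 'I_d -> int} :=
  [set x | (forall j, 0 <= x j) /\ (forall i j : 'I_d, (i < j)%N -> x i < x j)].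

Arguments Zplus d : clear implicits.

Definition neighbours (z : config) (a b : int) : bool :=
  `|site z a - site z b| == 1.

Definition move (d : nat) (x : {ffun 'I_d -> int}) (j : 'I_d) (a : int) :
    {ffun 'I_d -> int} :=
  [ffun k => if k == j then a else x k].

Definition label_rate (R : realType) (q : R) (d : nat) (z : config)
    (x x' : {ffun 'I_d -> int}) : R :=
  \sum_(j < d)
    (q * [&& x' == move x j (x j + 1), x j + 1 \notin codom x
           & neighbours z (x j) (x j + 1)]%:R
     + [&& x' == move x j (x j - 1), 0 <= x j - 1, x j - 1 \notin codom x
         & neighbours z (x j) (x j - 1)]%:R).

Definition coupled_state (d : nat) : Type := (Omega * Zplus d)%type.

HB.instance Definition _ (d : nat) := Choice.on (coupled_state d).

Definition xi_config (d : nat) (s : coupled_state d) : config := val s.1.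

Definition labels (d : nat) (s : coupled_state d) : {ffun 'I_d -> int} := val s.2.

Definition coupled_rate (R : realType) (q : R) (d : nat) (s s' : coupled_state d) : R :=
  (labels s' == labels s)%:R * asep_rate q (xi_config s) (xi_config s')
  + (xi_config s' == xi_config s)%:R * label_rate q (xi_config s) (labels s) (labels s').

Definition second_class_site (d : nat) (s : coupled_state d) (j : 'I_d) : int :=
  site (xi_config s) (labels s j).

Definition eta_config (d : nat) (s : coupled_state d) (i : int) : int :=
  (xi_config s i)%:R - \sum_(j < d) (i == second_class_site s j)%:R.

(* Main.v *)
(* The weight q^(I(xi) + x_1 + ... + x_d), where I(xi) is the number of pairs
   formed by a particle and a hole to its right, is in detailed balance with the
   rates. A stationary law with finite total jump rate has a density with respect
   to it that is constant along transitions, so on the level N = n the labels are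
   independent of xi and both laws are explicit.

   Inserting a particle at m, or a hole at m, and shifting one half of the
   configuration multiplies the weight by q^(number of holes to the right of m),
   resp. q^(number of particles to the left); this gives
   P(xi_m = 1, label k) = (q;q)_oo q^((k+1)l) / ((q;q)_k (q;q)_l), l = n - m + k + 1.
   The label k is missed by the d labels with a probability A(d,k) satisfying
   A(d+1,k) = (1 - q^k) A(d,k-1) + q^(k+1) A(d,k), and this recursion turns the sum
   over k of the n-summands times A(d,k) into the sum of the (n+d)-summands. *)
Require Import Defs.
From HB Require Import structures.
From mathcomp Require Import all_boot all_order all_algebra.
From mathcomp Require Import all_classical all_reals all_analysis.
From mathcomp Require Import ring zify.
Import Order.TTheory GRing.Theory Num.Theory.
Import numFieldNormedType.Exports.
Local Open Scope classical_set_scope.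
Local Open Scope ring_scope.

Set Implicit Arguments.
Unset Strict Implicit.
Unset Printing Implicit Defensive.

(** * Configurations, labels and inversions *)

(** The chain has infinitely many states and unbounded exit rates, so stationarity first gives only
    an inequality: the inflow into a state is at most its outflow. [reversible_unique] upgrades it
    to detailed balance. Its test function 1 / (1 + u) is decreasing, which produces a square, and
    bounded, so that a finite total flux is the only integrability required. The product measure
    supplies this finiteness: on the level, sites i and i + 1 differ with probability at most a
    constant times q^|i|, because particles are rare far to the left and holes are rare far to the
    right. Constancy of the density then reaches every state of the level, since each can be brought
    down to the step configuration with labels 0, ..., d - 1 by moves that lower the exponent of the
    weight. No partition function is computed: finiteness of the label mass follows from P having
    total mass 1, and (q;q)_oo appears as a limit, by comparing explicit probabilities with one that
    tends to 1. *)

Lemma int_succ_ind (Q : int -> Prop) (i0 : int) :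
  Q i0 -> (forall i : int, Q i -> Q (i + 1)) ->
  (forall i : int, Q (i + 1) -> Q i) ->
  forall i : int, Q i.
Proof.
move=> Q0 QS QP i; have -> : i = i0 + (i - i0) by lia.
case: (i - i0) => k.
  elim: k => [|k IH]; first by rewrite addr0.
  by have := QS _ IH; congr Q; lia.
elim: k => [|k IH].
  by apply: QP; move: Q0; congr Q; lia.
by apply: QP; move: IH; congr Q; lia.
Qed.

Lemma finite_set_int_bounded (A : set int) (N : nat) :
  (forall i : int, A i -> `|i| <= N%:Z) -> finite_set A.
Proof.
move=> AN; apply: (@sub_finite_set _ _ ((fun k : nat => k%:Z - N%:Z) @` `I_(2 * N).+1)).
  by move=> i /AN iN; exists (absz (i + N%:Z)) => /=; lia.
exact/finite_image/finite_II.
Qed.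

Lemma bounded_finite_set_int (A : set int) :
  finite_set A -> exists N : nat, forall i : int, A i -> `|i| <= N%:Z.
Proof.
move=> /finite_seqP[s ->]; exists (\sum_(i <- s) absz i)%N => i /= si.
rewrite (big_rem i si) /=; lia.
Qed.

Lemma OmegaP (z : config) : Omega z <->
  exists N : nat, forall i : int, (i < - N%:Z -> ~~ z i) /\ (N%:Z <= i -> z i).
Proof.
split.
  move=> [/bounded_finite_set_int[N1 h1] /bounded_finite_set_int[N2 h2]].
  exists (N1 + N2).+1 => i; split=> hi.
    by apply/negP => zi; have := h1 i; rewrite /= zi; lia.
  by apply/negPn/negP => zi; have := h2 i; rewrite /= zi; lia.
move=> [N hN]; split; apply: (@finite_set_int_bounded _ N) => i /= [hi zi].
  have := (hN i).1; rewrite zi; lia.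
have := (hN i).2; rewrite (negbTE zi); lia.
Qed.

Definition csum (f : int -> int) (i : int) : int :=
  \sum_(k \in [set k : int | k < i]) f k.

Lemma csum0 (f : int -> int) (i : int) :
  (forall k : int, k < i -> f k = 0) -> csum f i = 0.
Proof. by move=> f0; apply: fsbig1 => k /f0. Qed.

Lemma csumS (f : int -> int) (a i : int) :
  (forall k : int, k < a -> f k = 0) -> csum f (i + 1) = csum f i + f i.
Proof.
move=> f0; rewrite /csum.
pose D (j : int) := [set k : int | a <= k /\ k < j].
have csumD j : \sum_(k \in [set k : int | k < j]) f k = \sum_(k \in D j) f k.
  apply/esym/fsbig_widen => [k []//|k [/= kj]].
  rewrite /D /= => /not_andP[|//] /negP; rewrite -ltNge; exact: f0.
have Dfin j : finite_set (D j).
  by apply: (@finite_set_int_bounded _ (absz a + absz j)) => k [] /=; lia.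
rewrite !csumD; have [ai|ia] := leP a i; last first.
  rewrite f0// addr0; apply: eq_fsbigl; apply/seteqP; split=> k /=; rewrite /D/=; lia.
rewrite (fsbigD1 i) //=; last by rewrite /D/=; lia.
rewrite addrC; congr (_ + _); apply: eq_fsbigl; apply/seteqP; split=> k /=;
  rewrite /D/=.
  by move=> [? /eqP]; lia.
by move=> ?; split; [lia|apply/eqP; lia].
Qed.

(** A vanishing left tail and a one-site recurrence propagate in both directions to every site.
    Closed forms of infinite counts are thereby checked locally; [label_unique] and
    [inversions_unique] rest on it. *)
Lemma csum_unique (f g : int -> int) (a : int) :
  (forall k : int, k < a -> f k = 0) -> (forall k : int, k <= a -> g k = 0) ->
  (forall k : int, g (k + 1) = g k + f k) -> forall k : int, csum f k = g k.
Proof.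
move=> f0 g0 gS; apply: (@int_succ_ind _ a) => [|i|i].
- by rewrite csum0// g0.
- by rewrite (csumS _ f0) gS => ->.
- by rewrite (csumS _ f0) gS => /addIr.
Qed.

(** Particle-hole duality combined with reversal of the line. It preserves [Omega] and turns the
    holes at or right of [i] into the particles strictly left of [1 - i], so hole counts inherit the
    lemmas on labels. *)
Definition reflection (z : config) : config := fun k => ~~ z (- k).

Definition holes (z : config) (i : int) : int := label (reflection z) (1 - i).

Lemma reflection_Omega (z : config) : Omega z -> Omega (reflection z).
Proof.
move=> /OmegaP[N hN]; apply/OmegaP; exists N.+1 => i; rewrite /reflection negbK.
split=> hi; first by apply: (hN _).2; lia.
by apply: (hN _).1; lia.
Qed.

Lemma label_csum (z : config) : label z =1 csum (fun k => (z k)%:R).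
Proof. by []. Qed.

Lemma Omega_left (z : config) : Omega z ->
  exists a : int, forall k : int, k < a -> ~~ z k.
Proof. by move=> /OmegaP[N hN]; exists (- N%:Z) => k /(hN k).1. Qed.

Lemma Omega_right (z : config) : Omega z ->
  exists b : int, forall k : int, b <= k -> z k.
Proof. by move=> /OmegaP[N hN]; exists N%:Z => k /(hN k).2. Qed.

Lemma label0 (z : config) (i : int) :
  (forall k : int, k < i -> ~~ z k) -> label z i = 0.
Proof. by move=> z0; apply: csum0 => k /z0/negbTE ->. Qed.

Lemma labelS (z : config) (i : int) : Omega z ->
  label z (i + 1) = label z i + (z i)%:R.
Proof.
move=> /Omega_left[a za]; rewrite !label_csum (@csumS _ a)// => k ka.
by rewrite (negbTE (za _ ka)).
Qed.

Lemma label_unique (z : config) (g : int -> int) (a : int) : Omega z ->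
  (forall k : int, k <= a -> g k = 0) -> (forall k : int, g (k + 1) = g k + (z k)%:R) ->
  forall k : int, label z k = g k.
Proof.
move=> /Omega_left[b zb] g0 gS k; rewrite label_csum.
apply: (@csum_unique _ _ (Num.min a b)) => // j ja.
  by rewrite (negbTE (zb _ _))//; lia.
by apply: g0; lia.
Qed.

Lemma label_ge0 (z : config) (i : int) : 0 <= label z i.
Proof. by apply: fsumr_ge0 => k _; rewrite ler0n. Qed.

Lemma label_le (z : config) (i j : int) : Omega z -> i <= j -> label z i <= label z j.
Proof.
move=> Oz ij; have -> : j = i + (absz (j - i))%:Z by lia.
elim: (absz _) => [|k IH]; first by rewrite addr0.
by have := labelS (i + k%:Z) Oz; rewrite -addrA -PoszD addn1 => ->; lia.
Qed.

Lemma holes_ge0 (z : config) (i : int) : 0 <= holes z i.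
Proof. exact: label_ge0. Qed.

Lemma holesS (z : config) (i : int) : Omega z ->
  holes z i = holes z (i + 1) + (~~ z i)%:R.
Proof.
move=> Oz; rewrite /holes; have -> : 1 - i = (1 - (i + 1)) + 1 by lia.
by rewrite labelS; [rewrite /reflection; congr (_ + (~~ z _)%:R);
  lia|exact: reflection_Omega].
Qed.

Lemma holes0 (z : config) (i : int) : (forall k : int, i <= k -> z k) -> holes z i = 0.
Proof. by move=> z1; apply: label0 => k ki; rewrite /reflection negbK z1//; lia. Qed.

Lemma holes_unique (z : config) (g : int -> int) (b : int) : Omega z ->
  (forall k : int, b <= k -> g k = 0) ->
    (forall k : int, g k = g (k + 1) + (~~ z k)%:R) ->
  forall k : int, holes z k = g k.
Proof.
move=> Oz g0 gS; have [b' zb'] := Omega_right Oz.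
apply: (@int_succ_ind _ (Num.max b b')) => [|i|i].
- rewrite g0; [|lia]; apply: holes0 => k hk; apply: zb'; lia.
- by rewrite (gS i) (holesS i Oz) => /addIr.
- by rewrite (gS i) (holesS i Oz) => ->.
Qed.

(** Crossing a site gains a particle on the left or loses a hole on the right, so the difference
    falls by one per site; at site 1 it is the definition of the height. On a fixed level, hole
    counts can thus be read off labels. *)
Lemma holesB (z : config) (i : int) : Omega z ->
  holes z i - label z i = height z - i + 1.
Proof.
move=> Oz; move: i; apply: (@int_succ_ind _ 1) => [|i|i].
- rewrite /height subrK /holes subrr; congr (_ - _).
  rewrite /label (@reindex_fsbig _ _ _ _ _ (fun k : int => - k) [set k : int | 1 <= k]).
    by apply: eq_fsbigr => k _; rewrite /reflection opprK.
  split=> [k /= k1|x y _ _ /oppr_inj//|k /= kn]; first by rewrite oppr_lt0;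
    exact: lt_le_trans k1.
  by exists (- k); rewrite ?opprK//=; lia.
- by have := holesS i Oz; have := labelS i Oz; case: (z i) => /=; lia.
- by have := holesS i Oz; have := labelS i Oz; case: (z i) => /=; lia.
Qed.

Lemma label_lt (z : config) (i j : int) : Omega z -> z i -> i < j ->
  label z i < label z j.
Proof.
move=> Oz zi ij; apply: (@lt_le_trans _ _ (label z (i + 1))).
  by rewrite labelS// zi; lia.
by apply: label_le => //; lia.
Qed.

Lemma label_inj (z : config) (i j : int) : Omega z -> z i -> z j ->
  label z i = label z j -> i = j.
Proof.
move=> Oz zi zj eij; have [ij|ji|//] := ltgtP i j.
  by have := label_lt Oz zi ij; lia.
by have := label_lt Oz zj ji; lia.
Qed.

Lemma label_surj (z : config) (a : int) : Omega z -> 0 <= a ->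
  exists i : int, z i /\ label z i = a.
Proof.
move=> Oz a0; have [N hN] := (OmegaP z).1 Oz.
(* No particle lies left of [lo] and every site from [N] on is occupied. The least [k] for which the
   count up to site [lo + k] exceeds [a] ends at the particle with label [a]. *)
pose lo : int := - N%:Z; pose Q k := a < label z (lo + k%:Z + 1).
have exQ : exists k, Q k.
  exists (2 * N + absz a)%N; rewrite /Q.
  have grow k : k%:Z <= label z (N%:Z + k%:Z).
    elim: k => [|k IH]; first by rewrite label_ge0.
    have -> : N%:Z + k.+1%:Z = N%:Z + k%:Z + 1 by lia.
    by rewrite labelS// (hN _).2; lia.
  have := grow (absz a).+1; have ->
    : N%:Z + (absz a).+1 = lo + (2 * N + absz a)%N%:Z + 1 by lia.
  lia.
have [k Qk kmin] := ex_minnP exQ; exists (lo + k%:Z).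
have la : label z (lo + k%:Z) <= a.
  case: k Qk kmin => [|k] Qk kmin.
    rewrite addr0 label0//; move=> k /(hN k).1//.
  rewrite leNgt; apply/negP => h; have := kmin k; rewrite /Q.
  have -> : lo + k%:Z + 1 = lo + k.+1%:Z by lia.
  by move=> /(_ h); rewrite ltnn.
by move: Qk; rewrite /Q labelS//; case: (z _) => /=; lia.
Qed.

Lemma siteP (z : config) (a : int) : Omega z -> 0 <= a ->
  z (site z a) /\ label z (site z a) = a.
Proof.
move=> Oz a0; rewrite /site; case: xgetP => [i _ []//|].
by have [i hi] := label_surj Oz a0 => /(_ i).
Qed.

Lemma site_label (z : config) (i : int) : Omega z -> z i -> site z (label z i) = i.
Proof.
move=> Oz zi; have [zs ls] := siteP Oz (label_ge0 z i).
exact: label_inj ls.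
Qed.

(** An occupied site [k] is not a hole, so [holes z k] then counts exactly the holes to its
    right. *)
Definition inv_at (z : config) (k : int) : int := (z k)%:R * holes z k.

Definition inversions (z : config) : int := \sum_(k \in [set: int]) inv_at z k.

Lemma inversions_ge0 (z : config) : 0 <= inversions z.
Proof. by apply: fsumr_ge0 => k _; rewrite mulr_ge0// ?ler0n// holes_ge0. Qed.

Lemma inversions_unique (z : config) (g : int -> int) (a b c : int) : Omega z ->
  (forall k : int, k <= a -> g k = 0) ->
    (forall k : int, g (k + 1) = g k + inv_at z k) ->
  (forall k : int, b <= k -> g k = c) -> inversions z = c.
Proof.
move=> Oz g0 gS gc; have [a' za] := Omega_left Oz; have [b' zb] := Omega_right Oz.
pose B := Num.max b b'.
rewrite -(gc B); last by rewrite /B; lia.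
rewrite -(@csum_unique (inv_at z) g (Num.min a a')) => // [|k ka|k ka]; last 2 first.
- by rewrite /inv_at (negbTE (za _ _)) ?mul0r//; lia.
- by apply: g0; lia.
apply/esym/fsbig_widen => // k [_ /= /negP]; rewrite -leNgt => hk.
by rewrite /inv_at holes0 ?mulr0// => j hj; apply: zb; rewrite /B in hk; lia.
Qed.

Definition inv_upto (z : config) (i : int) : int := csum (inv_at z) i.

Lemma inv_uptoS (z : config) (i : int) : Omega z ->
  inv_upto z (i + 1) = inv_upto z i + inv_at z i.
Proof.
move=> /Omega_left[a za]; rewrite /inv_upto (@csumS _ a)// => k ka.
by rewrite /inv_at (negbTE (za _ ka)) mul0r.
Qed.

Lemma inv_upto_left (z : config) : Omega z ->
  exists a : int, forall k : int, k <= a -> inv_upto z k = 0.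
Proof.
move=> /Omega_left[a za]; exists a => k ka; apply: csum0 => j jk.
by rewrite /inv_at (negbTE (za _ _)) ?mul0r//; lia.
Qed.

Lemma inv_upto_right (z : config) : Omega z ->
  exists b : int, forall k : int, b <= k -> inv_upto z k = inversions z.
Proof.
move=> /Omega_right[b zb]; exists b => k bk; apply: fsbig_widen => // j [_ /= /negP].
rewrite -leNgt => kj; rewrite /inv_at holes0 ?mulr0// => i hi; apply: zb; lia.
Qed.

(** The inserted particle pushes the half line from [m] on to the right, where the tail is full; the
    inserted hole of [lshift] pushes the other half to the left, where the tail is empty. These
    directions preserve both [Omega] and the height. *)
Definition rshift (m : int) (z : config) : config :=
  fun i => if i < m then z i else if i == m then true else z (i - 1).

Definition lshift (m : int) (z : config) : config :=
  fun i => if i < m then z (i + 1) else if i == m then false else z i.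

Lemma rshift_Omega m z : Omega z -> Omega (rshift m z).
Proof.
move=> /OmegaP[N hN]; apply/OmegaP; exists (N + absz m).+1 => i; rewrite /rshift.
split=> hi; first by rewrite ifT; [apply: (hN _).1; lia|lia].
case: ifP => h1; first lia.
by case: ifP => h2 //; apply: (hN _).2; lia.
Qed.

Lemma lshift_Omega m z : Omega z -> Omega (lshift m z).
Proof.
move=> /OmegaP[N hN]; apply/OmegaP; exists (N + absz m).+1 => i; rewrite /lshift.
split=> hi; first by rewrite ifT; [apply: (hN _).1; lia|lia].
case: ifP => h1; first lia.
by case: ifP => h2 //; [lia|apply: (hN _).2; lia].
Qed.

Lemma exchange_Omega z i : Omega z -> Omega (exchange z i).
Proof.
move=> /OmegaP[N hN]; apply/OmegaP; exists (N + absz i).+2 => k; rewrite /exchange.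
split=> hk; (do 2?case: ifP => //); try lia; move=> *;
  [apply: (hN _).1|apply: (hN _).2]; lia.
Qed.

Lemma label_rshift m z i : Omega z ->
  label (rshift m z) i = if i <= m then label z i else label z (i - 1) + 1.
Proof.
move=> Oz; have [a za] := Omega_left Oz; move: i.
apply: (@label_unique _ _ (Num.min m a)) => [|k hk|k]; first exact: rshift_Omega.
  rewrite ifT; last lia.
  by apply: label0 => j hj; apply: za; lia.
rewrite /rshift; have [km|mk|->] := ltgtP k m.
- by rewrite (_ : k + 1 <= m); [exact: labelS|lia].
- rewrite (_ : (k + 1 <= m) = false); last lia.
  by have := labelS (k - 1) Oz; rewrite subrK addrK; lia.
- by rewrite (_ : (m + 1 <= m) = false) ?addrK//; lia.
Qed.

Lemma holes_rshift m z i : Omega z ->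
  holes (rshift m z) i = if i <= m then holes z i else holes z (i - 1).
Proof.
move=> Oz; have [b zb] := Omega_right Oz; move: i.
apply: (@holes_unique _ _ (Num.max m b + 1)) => [|k hk|k]; first exact: rshift_Omega.
  rewrite ifF; last lia.
  by apply: holes0 => j hj; apply: zb; lia.
rewrite /rshift; have [km|mk|->] := ltgtP k m.
- by rewrite (_ : k + 1 <= m); [exact: holesS|lia].
- rewrite (_ : (k + 1 <= m) = false); last lia.
  by have := holesS (k - 1) Oz; rewrite subrK addrK; lia.
- by rewrite (_ : (m + 1 <= m) = false) ?addrK ?addr0//; lia.
Qed.

Lemma height_rshift m z : Omega z -> height (rshift m z) = height z.
Proof.
move=> Oz; have := holesB m (rshift_Omega m Oz); have := holesB m Oz.
by rewrite label_rshift// holes_rshift// lexx; lia.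
Qed.

(** The old pairs keep their order, and the new particle at [m] is paired with the holes pushed to
    its right. *)
Lemma inversions_rshift m z : Omega z ->
  inversions (rshift m z) = inversions z + holes z m.
Proof.
move=> Oz; have [a pa] := inv_upto_left Oz; have [b pb] := inv_upto_right Oz.
apply: (@inversions_unique _ (fun i => if i <= m then inv_upto z i else inv_upto z (i
  - 1) + holes z m)
   (Num.min a m) (Num.max b m + 1)) => [|k hk|k|k hk].
- exact: rshift_Omega.
- rewrite ifT; last lia.
  by apply: pa; lia.
- rewrite /inv_at holes_rshift// /rshift; have [km|mk|->] := ltgtP k m.
  + by rewrite (_ : k + 1 <= m); [exact: inv_uptoS|lia].
  + rewrite (_ : (k + 1 <= m) = false); last lia.
    by have := inv_uptoS (k - 1) Oz; rewrite subrK addrK /inv_at; lia.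
  + by rewrite (_ : (m + 1 <= m) = false) ?addrK ?mul1r//; lia.
- rewrite ifF; last lia.
  by rewrite pb//; lia.
Qed.

Lemma label_lshift m z i : Omega z ->
  label (lshift m z) i = if i <= m then label z (i + 1) else label z i.
Proof.
move=> Oz; have [a za] := Omega_left Oz; move: i.
apply: (@label_unique _ _ (Num.min m a - 1)) => [|k hk|k]; first exact: lshift_Omega.
  rewrite ifT; last lia.
  by apply: label0 => j hj; apply: za; lia.
rewrite /lshift; have [km|mk|->] := ltgtP k m.
- by rewrite (_ : k + 1 <= m); [exact: labelS|lia].
- by rewrite (_ : (k + 1 <= m) = false); [exact: labelS|lia].
- by rewrite (_ : (m + 1 <= m) = false) ?addr0//; lia.
Qed.

Lemma holes_lshift m z i : Omega z ->
  holes (lshift m z) i = if i <= m then holes z (i + 1) + 1 else holes z i.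
Proof.
move=> Oz; have [b zb] := Omega_right Oz; move: i.
apply: (@holes_unique _ _ (Num.max m b + 1)) => [|k hk|k]; first exact: lshift_Omega.
  rewrite ifF; last lia.
  by apply: holes0 => j hj; apply: zb; lia.
rewrite /lshift; have [km|mk|->] := ltgtP k m.
- by rewrite (_ : k + 1 <= m); [have := holesS (k + 1) Oz; lia|lia].
- by rewrite (_ : (k + 1 <= m) = false); [exact: holesS|lia].
- by rewrite (_ : (m + 1 <= m) = false) //; lia.
Qed.

Lemma height_lshift m z : Omega z -> height (lshift m z) = height z.
Proof.
move=> Oz; have := holesB (m + 1) (lshift_Omega m Oz); have := holesB (m + 1) Oz.
by rewrite label_lshift// holes_lshift// !ifF; lia.
Qed.

(** The new hole at [m] is paired with the particles that were at sites up to [m] and now all lie to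
    its left. *)
Lemma inversions_lshift m z : Omega z ->
  inversions (lshift m z) = inversions z + label z (m + 1).
Proof.
move=> Oz; have [a pa] := inv_upto_left Oz; have [b pb] := inv_upto_right Oz.
have [a' za] := Omega_left Oz.
apply: (@inversions_unique _ (fun i => if i <= m then inv_upto z (i + 1) + label z (i
  + 1)
                              else inv_upto z i + label z (m + 1))
   (Num.min (Num.min a a') m - 1) (Num.max b m + 1)) => [|k hk|k|k hk].
- exact: lshift_Omega.
- rewrite ifT; last lia.
  rewrite pa; last lia.
  by rewrite label0// => j hj; apply: za; lia.
- rewrite /inv_at holes_lshift// /lshift; have [km|mk|->] := ltgtP k m.
  + rewrite (_ : k + 1 <= m); last lia.
    rewrite (inv_uptoS (k + 1) Oz) (labelS (k + 1) Oz) /inv_at.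
    by case: (z (k + 1)); rewrite ?mul1r ?mul0r /=; lia.
  + by rewrite (_ : (k + 1 <= m) = false); [rewrite inv_uptoS// /inv_at addrAC|lia].
  + by rewrite (_ : (m + 1 <= m) = false) ?mul0r ?addr0//; lia.
- rewrite ifF; last lia.
  by rewrite pb//; lia.
Qed.

Lemma label_exchange z i k : Omega z -> z i -> ~~ z (i + 1) ->
  label (exchange z i) k = label z k - (k == i + 1)%:R.
Proof.
move=> Oz zi zi1; have [a za] := Omega_left Oz; move: k.
apply: (@label_unique _ _ (Num.min i a)) => [|k hk|k]; first exact: exchange_Omega.
  rewrite (_ : k == i + 1 = false); last lia.
  by rewrite label0// => j hj; apply: za; lia.
rewrite labelS// /exchange; have [->|ki] := eqVneq k i.
  rewrite (negbTE zi1) zi eqxx (_ : i == i + 1 = false); last lia.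
  by rewrite /=; lia.
have -> : (k + 1 == i + 1) = false by lia.
have [->|ki1] := eqVneq k (i + 1); last by rewrite /=; lia.
by rewrite (negbTE zi1) zi; lia.
Qed.

Lemma holes_exchange z i k : Omega z -> z i -> ~~ z (i + 1) ->
  holes (exchange z i) k = holes z k - (k == i + 1)%:R.
Proof.
move=> Oz zi zi1; have [b zb] := Omega_right Oz; move: k.
apply: (@holes_unique _ _ (Num.max (i + 2) b)) => [|k hk|k];
  first exact: exchange_Omega.
  rewrite (_ : k == i + 1 = false); last lia.
  by rewrite holes0// => j hj; apply: zb; lia.
have := holesS k Oz => ->; rewrite /exchange; have [->|ki] := eqVneq k i.
  rewrite (negbTE zi1) zi eqxx (_ : i == i + 1 = false); last lia.
  by rewrite /=; lia.
have -> : (k + 1 == i + 1) = false by lia.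
have [->|ki1] := eqVneq k (i + 1); last by rewrite /=; lia.
by rewrite (negbTE zi1) zi /=; lia.
Qed.

Lemma height_exchange z i : Omega z -> z i -> ~~ z (i + 1) ->
  height (exchange z i) = height z.
Proof.
move=> Oz zi zi1; have := holesB i (exchange_Omega i Oz); have := holesB i Oz.
by rewrite label_exchange// holes_exchange//; lia.
Qed.

Lemma inversions_exchange z i : Omega z -> z i -> ~~ z (i + 1) ->
  inversions (exchange z i) = inversions z - 1.
Proof.
move=> Oz zi zi1; have [a pa] := inv_upto_left Oz; have [b pb] := inv_upto_right Oz.
have p1 : inv_upto z (i + 1) = inv_upto z i + holes z i by rewrite inv_uptoS//
  /inv_at zi mul1r.
have p2 : inv_upto z (i + 1 + 1) = inv_upto z (i + 1).
  by rewrite inv_uptoS// /inv_at (negbTE zi1) mul0r addr0.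
have h1 : holes z i = holes z (i + 1) by rewrite (holesS i Oz) zi addr0.
(* Candidate for the partial sums: the swap moves the contribution of the particle from [i] to
   [i + 1] and makes it smaller by one, since the swapped pair is the only one to change its
   order. *)
apply: (@inversions_unique _ (fun k => if k <= i then inv_upto z k else
    if k == i + 1 then inv_upto z i else inv_upto z k - 1)
   (Num.min a i) (Num.max b (i + 2))) => [|k hk|k|k hk].
- exact: exchange_Omega.
- rewrite ifT; last lia.
  by apply: pa; lia.
- rewrite /inv_at holes_exchange// /exchange; have [ki|ik|->] := ltgtP k i.
  + rewrite (_ : k + 1 <= i); last lia.
    by rewrite (_ : k == i + 1 = false) ?subr0; [exact: inv_uptoS|lia].
  + rewrite (_ : (k + 1 <= i) = false); last lia.
    have -> : (k + 1 == i + 1) = false by lia.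
    have [->|ki1] := eqVneq k (i + 1); first by rewrite zi; lia.
    by rewrite inv_uptoS// /inv_at subr0; lia.
  + by rewrite (_ : (i + 1 <= i) = false) ?eqxx ?(negbTE zi1) ?mul0r ?addr0//; lia.
- rewrite ifF; last lia.
  rewrite ifF; last lia.
  by rewrite pb//; lia.
Qed.

(** * Jump rates and reversibility *)

Lemma exchangeK (z : config) (i : int) : exchange (exchange z i) i = z.
Proof.
apply/funext => k; rewrite /exchange; have [->|ki] := eqVneq k i.
  by rewrite (_ : i + 1 == i = false) ?eqxx//; lia.
by have [->|//] := eqVneq k (i + 1); rewrite eqxx.
Qed.

Lemma exchange_id (z : config) (i : int) : z i = z (i + 1) -> exchange z i = z.
Proof.
move=> zi; apply/funext => k; rewrite /exchange; have [->//|_] := eqVneq k i.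
by have [->|//] := eqVneq k (i + 1).
Qed.

(** This leaves a single nonzero term in the sum defining [asep_rate]. *)
Lemma exchange_site_inj (z : config) (i j : int) :
  z i != z (i + 1) -> z j != z (j + 1) -> exchange z i = exchange z j -> i = j.
Proof.
move=> zi zj e; have E k := congr1 (fun f : config => f k) e.
have [ij|ji|//] := ltgtP i j; exfalso.
  move: (E i) zi; rewrite /exchange eqxx (_ : i == j = false); last lia.
  by rewrite (_ : i == j + 1 = false) => [->|]; [rewrite eqxx|lia].
move: (E j) zj; rewrite /exchange eqxx (_ : j == i = false); last lia.
by rewrite (_ : j == i + 1 = false) => [->|]; [rewrite eqxx|lia].
Qed.

Section AsepRate.
Variables (R : realType) (q : R).
Hypothesis q01 : 0 < q < 1.

Let q0 : 0 < q. Proof. by case/andP: q01. Qed.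
Let qn0 : q != 0. Proof. by rewrite gt_eqF. Qed.

Definition jump_rate (z : config) (i : int) : R :=
  (z i && ~~ z (i + 1))%:R + q * (~~ z i && z (i + 1))%:R.

Lemma jump_rate_ge0 z i : 0 <= jump_rate z i.
Proof. by rewrite addr_ge0// ?mulr_ge0// ?ler0n// ltW. Qed.

Lemma jump_rate_gt0 z i : z i != z (i + 1) -> 0 < jump_rate z i.
Proof.
rewrite /jump_rate; case: (z i); case: (z (i + 1)) => //= _.
  by rewrite mulr0 addr0.
by rewrite mulr1 add0r.
Qed.

Lemma jump_rate_eq0 z i : z i = z (i + 1) -> jump_rate z i = 0.
Proof. by rewrite /jump_rate => ->; case: (z _); rewrite /= mulr0 addr0. Qed.

Lemma jump_rate_le z i : jump_rate z i <= (z i != z (i + 1))%:R.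
Proof.
rewrite /jump_rate; case/andP: q01 => _ /ltW.
by case: (z i); case: (z (i + 1)); rewrite /= ?mulr0 ?mulr1 ?addr0 ?add0r.
Qed.

Lemma asep_rate_exchange z i :
  z i != z (i + 1) -> asep_rate q z (exchange z i) = jump_rate z i.
Proof.
move=> zi; rewrite /asep_rate -(@fsbig_widen int R 0 _ [set i] [set: int]) //=.
  by rewrite fsbig_set1 eqxx mul1r.
move=> j [_ /= ji]; have [/jump_rate_eq0 e|zj] := eqVneq (z j) (z (j + 1)).
  by rewrite -/(jump_rate z j) e mulr0.
case: eqP => [e|]; last by rewrite mul0r.
by exfalso; apply: ji; rewrite (exchange_site_inj zi zj e).
Qed.

Lemma asep_rate_ge0 z z' : 0 <= asep_rate q z z'.
Proof. by apply: fsumr_ge0 => i _; rewrite mulr_ge0// jump_rate_ge0. Qed.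

Lemma asep_rate_le z z' :
  ((asep_rate q z z')%:E <=
   \esum_(i in [set: int]) ((z' == exchange z i)%:R * jump_rate z i)%:E)%E.
Proof.
rewrite /asep_rate; case: finite_supportP => [_|X XT fX].
  (* An infinite support would make the sum 0 by convention; the inequality covers this case as
     well. *)
  by rewrite big_nil esum_ge0// => i _; rewrite lee_fin mulr_ge0// jump_rate_ge0.
move=> Xsupp; rewrite -sumEFin fsbig_seq ?fset_uniq//.
by apply: esum_ge; eexists; last exact: lexx; split=> //; exact: finite_fset.
Qed.

(** A jump to the right has rate 1 and destroys one inversion; its reverse has rate [q] and restores
    it. The two sums agree site by site because an exchange is its own inverse. *)
Lemma asep_reversible z z' : Omega z -> Omega z' ->
  q ^ (inversions z) * asep_rate q z z' = q ^ (inversions z') * asep_rate q z' z.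
Proof.
move=> Oz Oz'; rewrite !mulr_fsumr; apply: eq_fsbigr => i _.
rewrite -!/(jump_rate _ _).
have [->|ne] := eqVneq z' (exchange z i); last first.
  rewrite mul0r mulr0 [in RHS](_ : _ == _ = false) ?mul0r ?mulr0//.
  by apply/negbTE/eqP => e; move: ne; rewrite e exchangeK eqxx.
rewrite exchangeK eqxx !mul1r.
case zi: (z i); case zi1: (z (i + 1)); last 1 first.
- by rewrite exchange_id// zi zi1.
- by rewrite exchange_id// zi zi1.
- rewrite inversions_exchange//; last by rewrite zi1.
  rewrite /jump_rate zi zi1 /exchange eqxx (_ : i + 1 == i = false); last lia.
  rewrite eqxx zi zi1 /= mulr0 add0r mulr1 addr0 expfzDr// mulr1.
  by rewrite -mulrA mulVf ?mulr1.
- have Oe := exchange_Omega i Oz.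
  have e : inversions z = inversions (exchange z i) - 1.
    rewrite -{1}(exchangeK z i) inversions_exchange// /exchange eqxx ?zi1//.
    by rewrite (_ : i + 1 == i = false) ?eqxx ?zi//; lia.
  rewrite e /jump_rate zi zi1 /exchange eqxx (_ : i + 1 == i = false); last lia.
  rewrite eqxx zi zi1 /= mulr0 add0r mulr1 addr0 expfzDr// mulr1.
  by rewrite -mulrA mulVf ?mulr1.
Qed.

End AsepRate.

Definition ground (n : int) : config := fun i => n < i.

Lemma ground_Omega n : Omega (ground n).
Proof.
apply/OmegaP; exists (absz n).+1 => i; rewrite /ground; split; lia.
Qed.

Lemma label_ground n i : label (ground n) i = Num.max 0 (i - n - 1).
Proof.
move: i; apply: (@label_unique _ (fun i :
  int => Num.max 0 (i - n - 1)) n (ground_Omega n)) => /= k; rewrite /ground; lia.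
Qed.

Lemma holes_ground n i : holes (ground n) i = Num.max 0 (n - i + 1).
Proof.
move: i; apply: (@holes_unique _ (fun i :
  int => Num.max 0 (n - i + 1)) (n + 1) (ground_Omega n)) => /= k; rewrite /ground; lia.
Qed.

Lemma height_ground n : height (ground n) = n.
Proof.
have := holesB (n + 1) (ground_Omega n); rewrite label_ground holes_ground; lia.
Qed.

Lemma site_ground n a : 0 <= a -> site (ground n) a = n + 1 + a.
Proof.
move=> a0; have e : label (ground n) (n + 1 + a) = a by rewrite label_ground; lia.
rewrite -{1}e site_label//; first exact: ground_Omega.
rewrite /ground; lia.
Qed.

(** If no particle is followed by a hole, the occupied sites are closed upwards, and the level fixes
    where they begin. *)
Lemma exists_descent n z : level n z -> z <> ground n ->
  exists i : int, z i /\ ~~ z (i + 1).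
Proof.
move=> [Oz /= hz] zg; apply: contrapT => nd; apply: zg.
have up i (k : nat) : z i -> z (i + k%:Z).
  move=> zi; elim: k => [|k IH]; first by rewrite addr0.
  have -> : i + k.+1%:Z = i + k%:Z + 1 by lia.
  by apply/negPn/negP => zk; apply: nd; exists (i + k%:Z).
have up' i j : z i -> i <= j -> z j.
  by move=> zi ij; have -> : j = i + (absz (j - i))%:Z by [lia|]; exact: up.
have := holesB (n + 1) Oz; rewrite hz => hl.
have [a za] := Omega_left Oz; have [b zb] := Omega_right Oz.
(* On level [n] the particles left of [n + 1] are as many as the holes from [n + 1] on. A particle
   on the left would fill the whole right side, so both counts vanish. *)
have l0 : label z (n + 1) = 0.
  have [//|lp] := eqVneq (label z (n + 1)) 0.
  have [i [i1 zi]] : exists i, i < n + 1 /\ z i.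
    apply: contrapT => h; move/eqP: lp; apply; apply: label0 => k kn.
    by apply/negP => zk; apply: h; exists k.
  have : holes z (n + 1) = 0 by apply: holes0 => k kn; apply: (up' _ _ zi); lia.
  lia.
have h0 : holes z (n + 1) = 0 by lia.
apply/funext => i; rewrite /ground; have [ni|ni] := ltP n i.
  apply/negPn/negP => zi; have := holesS i Oz; rewrite zi.
  have : holes z i <= holes z (n + 1).
    have := holesB i Oz; have := @label_le z (n + 1) i Oz; rewrite hz => A B.
    have C : holes (z) i <= holes z (n + 1).
      by apply: (@label_le (reflection z)); [exact: reflection_Omega|lia].
    exact: C.
  by have := holes_ge0 z (i + 1); lia.
apply/negP => zi; have := @label_lt z i (n + 1) Oz zi; have := label_ge0 z i; lia.
Qed.

Lemma Zplus_inj d (x : {ffun 'I_d -> int}) : Zplus d x -> injective x.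
Proof.
move=> [_ xlt] i j e; have [ij|ji|] := ltngtP i j; last exact: val_inj.
  by have := xlt _ _ ij; rewrite e ltxx.
by have := xlt _ _ ji; rewrite e ltxx.
Qed.

Lemma moveK d (x : {ffun 'I_d -> int}) j a : move (move x j a) j (x j) = x.
Proof. by apply/ffunP => k; rewrite !ffunE; case: eqP => // ->. Qed.

Lemma sum_move d (x : {ffun 'I_d -> int}) j a :
  \sum_i move x j a i = \sum_i x i + (a - x j).
Proof.
rewrite (bigD1 j)//= [in RHS](bigD1 j)//= ffunE eqxx.
rewrite (eq_bigr x); first ring.
by move=> i /negbTE ij; rewrite ffunE ij.
Qed.

Lemma move_Zplus d (x : {ffun 'I_d -> int}) j : Zplus d x -> 0 <= x j - 1 ->
  x j - 1 \notin codom x -> Zplus d (move x j (x j - 1)).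
Proof.
move=> [x0 xlt] xj0 xjc; split=> [k|i k ik].
  by rewrite ffunE; case: ifP.
rewrite !ffunE; have ne l : x l != x j - 1.
  by apply: contraNneq xjc => <-; exact: codom_f.
case: eqP => ij; case: eqP => kj.
- by move: ik; rewrite ij kj ltnn.
- by have := xlt _ _ ik; rewrite ij; lia.
- by have := xlt _ _ ik; rewrite kj; have := ne i; lia.
- exact: xlt.
Qed.

Definition packed d : {ffun 'I_d -> int} := [ffun j : 'I_d => (j : nat)%:Z].

Lemma packed_Zplus d : Zplus d (packed d).
Proof. by split=> [j|i j ij]; rewrite !ffunE. Qed.

Lemma exists_down_move d (x : {ffun 'I_d -> int}) : Zplus d x -> x <> packed d ->
  exists j, 0 <= x j - 1 /\ x j - 1 \notin codom x.
Proof.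
move=> [x0 xlt] xp; apply: contrapT => nd; apply: xp.
suff E (j : 'I_d) : x j = (j : nat)%:Z by apply/ffunP => j; rewrite E ffunE.
(* Strong induction on the index: if [x j] cannot step down and its predecessor has value [j - 1],
   only that value can block it. *)
have [k] := ubnP (j : nat); elim: k j => // k IH j jk.
have {}nd : x j - 1 < 0 \/ x j - 1 \in codom x.
  have [h|h] := ltP (x j - 1) 0; [by left|right].
  by apply/negPn/negP => hc; apply: nd; exists j.
have [j0|j0] := posnP (j : nat).
  rewrite j0; case: nd => [|/codomP[i xi]]; first by have := x0 j; lia.
  have : x j <= x i.
    have [/val_inj->//|ij] := eqVneq (j : nat) i.
    by apply/ltW/xlt; rewrite j0 lt0n -j0 eq_sym.
  lia.
have pj : (j.-1 < d)%N by rewrite (leq_ltn_trans (leq_pred _)).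
pose p := Ordinal pj; have xp : x p = (j.-1)%:Z by apply: IH => /=; lia.
have pltj : (p < j)%N by rewrite /= prednK.
have xpj := xlt _ _ pltj; case: nd => [|/codomP[i xi]]; first lia.
have ij : (i < j)%N.
  rewrite ltnNge; apply/negP; rewrite leq_eqVlt => /orP[/eqP/val_inj e|/xlt]; last lia.
  by rewrite e in xi; lia.
have : x i <= x p.
  have [/val_inj->//|ip] := eqVneq (i : nat) p.
  by apply/ltW/xlt; rewrite ltn_neqAle ip /= -ltnS prednK.
lia.
Qed.

Section LabelRate.
Variables (R : realType) (q : R).
Hypothesis q01 : 0 < q < 1.

Let q0 : 0 < q. Proof. by case/andP: q01. Qed.
Let qn0 : q != 0. Proof. by rewrite gt_eqF. Qed.

Lemma neighboursC z a b : neighbours z a b = neighbours z b a.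
Proof. by rewrite /neighbours distrC. Qed.

Lemma label_rate_ge0 d z (x x' : {ffun 'I_d -> int}) : 0 <= label_rate q z x x'.
Proof. by apply: sumr_ge0 => j _; rewrite addr_ge0// mulr_ge0// ltW. Qed.

Let up d z (x x' : {ffun 'I_d -> int}) j :=
  [&& x' == move x j (x j + 1), x j + 1 \notin codom x & neighbours z (x j) (x j + 1)].
Let down d z (x x' : {ffun 'I_d -> int}) j :=
  [&& x' == move x j (x j - 1), 0 <= x j - 1, x j - 1 \notin codom x
    & neighbours z (x j) (x j - 1)].

Let codom_move d (x : {ffun 'I_d -> int}) j a : Zplus d x -> a != x j ->
  x j \notin codom (move x j a).
Proof.
move=> /Zplus_inj xi ax; apply/negP => /codomP[k]; rewrite ffunE.
by have [_ e|kj /xi e] := eqVneq k j; [rewrite e eqxx in ax|rewrite e eqxx in kj].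
Qed.

Let up_down d z (x x' : {ffun 'I_d -> int}) j : Zplus d x -> Zplus d x' ->
  up z x x' j = down z x' x j.
Proof.
move=> Zx Zx'; apply/idP/idP.
  move=> /and3P[/eqP e xc nb]; have xj : x' j - 1 = x j by rewrite e ffunE eqxx; lia.
  rewrite /down xj e moveK eqxx Zx.1 codom_move//; last lia.
  by rewrite ffunE eqxx neighboursC.
move=> /and4P[/eqP e xc nc nb]; have xj : x j + 1 = x' j by rewrite e ffunE eqxx; lia.
rewrite /up xj e moveK eqxx codom_move//; last lia.
by rewrite ffunE eqxx neighboursC.
Qed.

(** An upward move has rate [q] and raises the label sum by one; its reverse has rate 1. Both obey
    the same adjacency condition, and the value just left is free again, so the terms match
    coordinate by coordinate. *)
Lemma label_reversible d z (x x' : {ffun 'I_d -> int}) : Zplus d x -> Zplus d x' ->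
  q ^ (\sum_j x j) * label_rate q z x x' = q ^ (\sum_j x' j) * label_rate q z x' x.
Proof.
move=> Zx Zx'; rewrite !mulr_sumr; apply: eq_bigr => j _.
rewrite -!/(up z _ _ j) -!/(down z _ _ j) (up_down _ _ Zx' Zx) -(up_down _ _ Zx Zx').
have [/and3P[/eqP e _ _]|_] := boolP (up z x x' j).
  have [/and4P[/eqP e' _ _ _]|_] := boolP (down z x x' j).
    by have := congr1 (fun f : {ffun _} => f j) e; rewrite e' !ffunE eqxx; lia.
  rewrite e sum_move /= mulr0 add0r mulr1 addr0 (_ : x j + 1 - x j = 1); last lia.
  rewrite expfzDr//.
  by rewrite mulr1.
have [/and4P[/eqP e _ _ _]|_] := boolP (down z x x' j); last first.
  by rewrite /= mulr0 addr0 !mulr0.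
rewrite e sum_move /= mulr0 add0r mulr1 addr0 (_ : x j - 1 - x j = - 1); last lia.
by rewrite expfzDr// -mulrA exprN1 mulr1 mulVf// mulr1.
Qed.

Lemma label_rate_gt0 d z (x : {ffun 'I_d -> int}) j : 0 <= x j - 1 ->
  x j - 1 \notin codom x -> neighbours z (x j) (x j - 1) ->
  0 < label_rate q z x (move x j (x j - 1)).
Proof.
move=> x0 xc nb; rewrite /label_rate (bigD1 j)//= eqxx x0 xc nb /=.
rewrite ltr_pwDl//; last first.
  by apply: sumr_ge0 => i _; rewrite addr_ge0// mulr_ge0// ltW.
by rewrite ltr_wpDl// mulr_ge0// ltW.
Qed.

Lemma label_rate_le d z (x x' : {ffun 'I_d -> int}) :
  label_rate q z x x' <=
  \sum_(j < d) ((x' == move x j (x j + 1))%:R + (x' == move x j (x j - 1))%:R).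
Proof.
have mono (a b : bool) : (a && b)%:R <= a%:R :> R by case: a; case: b.
apply: ler_sum => j _; apply: lerD; last exact: mono.
apply: le_trans (mono _ ([&& x j + 1 \notin codom x & neighbours z (x j) (x j + 1)])).
by rewrite ler_piMl// ltW//; case/andP: q01.
Qed.

End LabelRate.

(** * Laws of stationary reversible chains *)

Lemma esumZl (R : realType) (I : choiceType) (D : set I) (a : I -> \bar R) (r : R) :
  0 <= r -> (forall i, (0 <= a i)%E) ->
  (\esum_(i in D) (r%:E * a i) = r%:E * \esum_(i in D) a i)%E.
Proof.
move=> r0 a0; rewrite [in RHS]/esum -ereal_supZl//; last first.
  by apply/set0P; exists (\sum_(i \in set0) a i)%E, set0 => //; exact: fsets_set0.
rewrite image_comp /esum; congr ereal_sup; apply/eq_imagel => X _ /=.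
by rewrite ge0_mule_fsumr.
Qed.

Lemma esum_indicator_le (R : realType) (I : choiceType) (D : set I) (Q : I ->
  bool) (r : R) :
  0 <= r -> (forall i j, Q i -> Q j -> i = j) ->
  (\esum_(i in D) ((Q i)%:R * r)%:E <= r%:E)%E.
Proof.
move=> r0 Quniq; have [[i0 Qi0]|nQ] := pselect (exists i, Q i); last first.
  rewrite esum1 ?lee_fin// => i _; case Qi : (Q i); last by rewrite mul0r.
  by exfalso; apply: nQ; exists i.
rewrite esum_mkcond (esumID [set i0])//; last first.
  by move=> i _; case: ifP => // _; rewrite lee_fin mulr_ge0.
rewrite setTI esum_set1; last by case: ifP => // _; rewrite lee_fin mulr_ge0.
rewrite esum1 ?adde0; last first.
  move=> i [_ /= ii0]; case: ifP => // _; case Qi : (Q i); last by rewrite mul0r.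
  by exfalso; apply: ii0; exact: Quniq.
by case: ifP => _; rewrite lee_fin// Qi0 mul1r.
Qed.

Section ReversibleUniqueness.
Variables (R : realType) (S : choiceType) (rate : S -> S -> R) (w lam : S -> R).
Hypothesis rate_ge0 : forall s s', 0 <= rate s s'.
Hypothesis w_gt0 : forall s, 0 < w s.
Hypothesis rev : forall s s', w s * rate s s' = w s' * rate s' s.
Hypothesis lam_ge0 : forall s, 0 <= lam s.
Hypothesis sub : forall s, (\esum_(r in [set r | r != s]) (lam r * rate r s)%:E <=
                            \esum_(r in [set r | r != s]) (lam s * rate s r)%:E)%E.
Hypothesis fin : (\esum_(s in [set: S])
  \esum_(r in [set r | r != s]) (lam s * rate s r)%:E < +oo)%E.

(* Test the inequality [sub] against 1 / (1 + u) with u = lam / w. Symmetrising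
   the sums, sub forces the sum of
   w s * rate s r * (u s - u r)^2 / ((1 + u s) (1 + u r)) to be nonpositive. *)
Lemma reversible_unique s0 s1 : s0 != s1 -> 0 < rate s0 s1 ->
  lam s0 * w s1 = lam s1 * w s0.
Proof.
move=> s01 r01; pose u s := lam s / w s; pose g s := (1 + u s)^-1.
pose K s r := w s * rate s r.
have wn0 s : w s != 0 by rewrite gt_eqF.
have u0 s : 0 <= u s by rewrite divr_ge0// ltW.
have u1 s : 0 < 1 + u s by rewrite ltr_pwDl.
have g0 s : 0 <= g s by rewrite invr_ge0 ltW.
have K0 s r : 0 <= K s r by rewrite mulr_ge0// ltW.
have K3 s r a b : (0 <= (K s r * u a * g b)%:E)%E.
  by rewrite lee_fin; apply: mulr_ge0 => //; apply: mulr_ge0.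
have KC s r : K s r = K r s by exact: rev.
have lamK s r : lam s * rate s r = K s r * u s by rewrite /K /u; field.
pose N (s : S) := [set r | r != s].
pose D := [set: S] `*`` N.
have Dswap : set_bij D D (fun k => (k.2, k.1)).
  split=> [[s r] [_ /= rs]|[s r] [s' r'] _ _ [-> ->]//|[s r] [_ /= rs]].
    by split=> //; rewrite /N /= eq_sym.
  by exists (r, s) => //; split=> //; rewrite /N /= eq_sym.
pose A := (\esum_(k in D) (K k.1 k.2 * u k.2 * g k.1)%:E)%E.
pose B := (\esum_(k in D) (K k.1 k.2 * u k.1 * g k.1)%:E)%E.
pose E := (\esum_(k in D) (K k.1 k.2 * (u k.1 - u k.2) ^+ 2 * (g k.1 * g k.2))%:E)%E.
(* This is the hypothesis [sub], multiplied by [g s] and summed over [s]. *)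
have AB : (A <= B)%E.
  rewrite /A -(@esum_esum _ _ _ _ N (fun s r => (K s r * u r * g s)%:E)); last first.
    by move=> s r *; exact: (K3 s r).
  rewrite /B -(@esum_esum _ _ _ _ N (fun s r => (K s r * u s * g s)%:E)); last first.
    by move=> s r *; exact: (K3 s r).
  apply: le_esum => s _.
  under eq_esum do rewrite mulrC EFinM.
  rewrite esumZl; [|exact: g0|by move=> r; rewrite lee_fin; apply: mulr_ge0].
  under [leRHS]eq_esum do rewrite mulrC EFinM.
  rewrite esumZl; [|exact: g0|by move=> r; rewrite lee_fin; apply: mulr_ge0].
  rewrite lee_wpmul2l ?lee_fin//.
  under eq_esum do rewrite KC -lamK.
  under [leRHS]eq_esum do rewrite -lamK.
  exact: sub.
(* Since [g] is at most 1, the total flux bounds [B]; finiteness is what allows [B + B] to be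
   cancelled later. *)
have Bfin : (B < +oo)%E.
  apply: le_lt_trans fin.
  rewrite /B -(@esum_esum _ _ _ _ N (fun s r => (K s r * u s * g s)%:E)); last first.
    by move=> s r *; exact: (K3 s r).
  apply: le_esum => s _; apply: le_esum => r _; rewrite lee_fin lamK.
  by rewrite ler_piMr ?invf_le1 ?lerDl//; apply: mulr_ge0.
have AA : A = (\esum_(k in D) (K k.1 k.2 * u k.1 * g k.2)%:E)%E.
  by rewrite /A (@reindex_esum _ _ _ _ _ _ _ Dswap); apply: eq_esum => -[s r] _ /=;
    rewrite KC.
have BB : B = (\esum_(k in D) (K k.1 k.2 * u k.2 * g k.2)%:E)%E.
  by rewrite /B (@reindex_esum _ _ _ _ _ _ _ Dswap); apply: eq_esum => -[s r] _ /=;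
    rewrite KC.
have E3 s r : (0 <= (K s r * (u s - u r) ^+ 2 * (g s * g r))%:E)%E.
  rewrite lee_fin; apply: mulr_ge0; last exact: mulr_ge0.
  by apply: mulr_ge0 => //; exact: sqr_ge0.
have E0 : (0 <= E)%E.
  by apply: esum_ge0 => k _; exact: E3.
have A0 : (0 <= A)%E by apply: esum_ge0 => k _; exact: K3.
have B0 : (0 <= B)%E by apply: esum_ge0 => k _; exact: K3.
(* With one copy of [A] and of [B] in swapped variables, the identity reduces to
   [g s - g r = (u r - u s) * (g s * g r)]. *)
have ABE : (A + A = (B + B) + E)%E.
  rewrite [X in (X + _ = _)%E]AA [X in (_ = X + _ + _)%E]BB /A /B /E.
  rewrite -!esumD;
    try by move=> k _; do ?[exact: K3 | exact: E3 | apply: adde_ge0].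
  apply: eq_esum => -[s r] _ /=; rewrite -!EFinD; congr EFin.
  have gs : 1 + u s != 0 by rewrite gt_eqF.
  have gr : 1 + u r != 0 by rewrite gt_eqF.
  by rewrite /g; field; rewrite gs gr.
have : (E <= 0)%E.
  have Bf : B \is a fin_num by rewrite ge0_fin_numE.
  have : ((B + B) + E <= B + B)%E by rewrite -ABE leeD.
  by rewrite -{2}[(B + B)%E]adde0 leeD2lE// fin_numD Bf.
have Dk : D (s0, s1) by split=> //; rewrite /N /= eq_sym.
have : ((K s0 s1 * (u s0 - u s1) ^+ 2 * (g s0 * g s1))%:E <= E)%E.
  apply: esum_ge; exists [set (s0, s1)]; first by split=> // _ ->.
  by rewrite fsbig_set1.
move=> /le_trans h /h; rewrite lee_fin.
have Kg : 0 < K s0 s1 * (g s0 * g s1).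
  by rewrite !mulr_gt0// invr_gt0.
rewrite mulrAC pmulr_rle0// => h2.
have /eqP : (u s0 - u s1) ^+ 2 = 0 by apply/eqP; rewrite eq_le h2 sqr_ge0.
rewrite sqrf_eq0 subr_eq0 /u => /eqP e.
have := wn0 s0; have := wn0 s1 => ? ?.
have -> : lam s0 = lam s0 / w s0 * w s0 by field.
by rewrite e; field.
Qed.

End ReversibleUniqueness.

(** The state space carries no sigma-algebra, so the law of [X] is assembled from its fibres through
    an injection of [D] into the natural numbers. *)
Lemma measure_countable_decomp (R : realType) d (T : measurableType d)
    (P : {measure set T -> \bar R}) (S : choiceType) (X : T -> S) (G : set T)
    (D A : set S) :
  countable D -> (forall w, D (X w)) ->
  (forall s, measurable (G `&` X @^-1` [set s])) ->
  P (G `&` X @^-1` A) = \esum_(s in A `&` D) P (G `&` X @^-1` [set s]).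
Proof.
move=> /countable_injP[f finj] XD mX; set B := A `&` D.
have Binj : {in B &, injective f}.
  by move=> x y; rewrite !inE => -[_ Dx] [_ Dy]; apply: finj; rewrite inE.
(* At most one state of [B] has code [i]: [F i] is its fibre within [G], or empty if there is
   none. *)
pose F (i : nat) := \bigcup_(s in B `&` [set s | f s = i]) (G `&` X @^-1` [set s]).
have Fs s : B s -> F (f s) = G `&` X @^-1` [set s].
  move=> Bs; apply/seteqP; split=> [t [s' [Bs' /= e]]|t h]; last by exists s.
  by rewrite (Binj s' s)// ?inE.
have F0 i : ~ (f @` B) i -> F i = set0.
  by move=> nBi; apply/seteqP; split=> // t [s [Bs /= e] _]; apply: nBi; exists s.
have mF i : measurable (F i).
  have [[s Bs <-]|/F0->//] := pselect ((f @` B) i).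
  by rewrite Fs.
have -> : G `&` X @^-1` A = \bigcup_i F i.
  apply/seteqP; split=> [t [Gt At]|t [i _ [s [[As _] _] [Gt /= ->]]]//].
  by exists (f (X t)) => //; exists (X t) => //; split=> //; split => //; exact: XD.
rewrite measure_semi_bigcup//; last first.
- exact: bigcupT_measurable.
- move=> i j _ _ [t [[s [_ /= <-] [_ /= Xs]] [s' [_ /= <-] [_ /= Xs']]]].
  by rewrite -Xs -Xs'.
rewrite nneseries_esumT//.
transitivity (\esum_(i in f @` B) P (F i)).
  rewrite [RHS]esum_mkcond; apply: eq_esum => i _; case: ifPn => // /negP.
  by rewrite inE => /F0->; rewrite measure0.
by rewrite esum_image//; apply: eq_esum => s Bs; rewrite Fs.
Qed.

(** The paths that sit at [s] at time [h] and come from a given finite set of states at time 0 have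
    at most mass [lam s]. Dividing by [h] and letting [h] tend to 0 bounds the inflow from each
    finite set. The limit is never exchanged with an infinite sum of sources, hence an
    inequality. *)
Lemma law_flux_le (R : realType) (S : choiceType) (rate : S -> S -> R) d
    (T : measurableType d) (P : probability T R) (Y : R -> T -> S) :
  countable [set: S] -> (forall s s', 0 <= rate s s') ->
  markov_jump_process rate P Y -> stationary P Y ->
  let lam s := fine (P (Y 0 @^-1` [set s])) in
  forall s, (\esum_(r in [set r | r != s]) (lam r * rate r s)%:E <=
             \esum_(r in [set r | r != s]) (lam s * rate s r)%:E)%E.
Proof.
move=> cS rate0 [mY _ [p [[p0 _ _ _] [prate pq] markov]]] stat lam s.
have lam0 r : 0 <= lam r by rewrite fine_ge0.
have lamE r : P (Y 0 @^-1` [set r]) = (lam r)%:E by rewrite fineK//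
  fin_num_measure//; exact: mY.
apply: ge_ereal_sup => _ [F [/finite_seqP[X' FX'] Fs] <-].
pose X := undup X'.
have {FX'} FX : F = [set` X] by rewrite FX'; apply/seteqP; split=> r /=;
  rewrite mem_undup.
have Xs r : r \in X -> r != s by move=> rX; apply: Fs; rewrite FX.
rewrite {F Fs} FX -fsbig_seq ?undup_uniq// sumEFin.
have flow h : 0 <= h -> \sum_(r <- X) lam r * p h r s <= lam s * (1 - p h s s).
  move=> h0; rewrite mulrBr mulr1 lerBrDr.
  (* The Markov property with an empty past, indexed by ['I_0], gives the joint law at times 0 and
     [h]. *)
  have two r : P (Y 0 @^-1` [set r] `&` Y h @^-1` [set s]) = (lam r * p h r s)%:E.
    have := markov 0%N (fun _ => 0) (fun _ => s) 0 h r s.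
    rewrite add0r => e; rewrite EFinM -lamE.
    transitivity (P ([set w | forall i : 'I_0, Y 0 w = s] `&`
              [set w | Y 0 w = r] `&` [set w | Y h w = s])).
      by congr (P _); apply/seteqP; split=> w /= [a b]; [split=> //;
        split=> // -[]|case: a].
    rewrite e//; last by case.
    congr (P _ * _)%E; apply/seteqP; split=> w /=; first by case.
    by split=> // -[].
  have uniqX : uniq (s :: X).
    by rewrite /= undup_uniq andbT; apply/negP => /Xs; rewrite eqxx.
  have : (\sum_(r <- s :: X) (lam r * p h r s)%:E <= (lam s)%:E)%E.
    rewrite -lamE -[in leRHS](stat h)//.
    rewrite [leRHS](_ : _ = P (Y h @^-1` [set s] `&` Y 0 @^-1` setT)); last first.
      by rewrite preimage_setT setIT.
    rewrite (@measure_countable_decomp _ _ _ _ _ _ _ [set: S])//; last first.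
      by move=> r; apply: measurableI; exact: mY.
    rewrite setTI; apply: esum_ge; exists [set` s :: X]; first by split.
    rewrite -fsbig_seq ?uniqX//; apply: lee_sum => r _.
    by rewrite -two setIC.
  by rewrite big_cons sumEFin -EFinD lee_fin addrC.
apply: (@lee_cvg_to R (0^'+) _ R
   (fun h => \sum_(r <- X | r \in X) (lam r * (h^-1 * p h r s))%:E)%E
   (fun h => (lam s)%:E * (h^-1 * (1 - p h s s))%:E)%E).
- rewrite -sumEFin big_seq; apply: cvg_nnesum => r rX.
    near=> h; have h0 : 0 <= h by exact: ltW.
    by rewrite lee_fin mulr_ge0// mulr_ge0 ?invr_ge0 ?p0.
  by apply: cvg_EFin; [exact: nearW|exact: cvgMl_tmp (prate _ _ (Xs _ rX))].
- under eq_esum do rewrite EFinM.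
  rewrite esumZl; [|exact: lam0|by move=> r; rewrite lee_fin].
  by apply: cvgeZl; [|exact: pq].
- near=> h; have h0 : 0 < h by [].
  rewrite -big_seq sumEFin -EFinM lee_fin mulrCA -ler_pdivrMl ?invr_gt0// invrK.
  rewrite mulr_sumr (le_trans _ (flow _ (ltW h0)))// le_eqVlt; apply/orP; left.
  by apply/eqP/eq_bigr => r _; rewrite mulrCA mulVKf ?gt_eqF.
Unshelve. all: end_near. Qed.

(** * Countability and summability *)

Lemma Omega_countable : countable Omega.
Proof.
(* A configuration in [Omega] is determined by a cut-off [N] and its values on the [2 * N] sites
   from [- N] to [N - 1]. *)
pose decode (k : nat * seq bool) : config := fun i =>
  if i < - k.1%:Z then false else if k.1%:Z <= i then true
  else nth false k.2 (absz (i + k.1%:Z)).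
apply: (@sub_countable _ _ _ (decode @` [set: nat * seq bool])); last first.
  exact: card_le_trans (card_image_le _ _) (countableP _).
apply: subset_card_le => z /OmegaP[N hN].
exists (N, mkseq (fun j => z (j%:Z - N%:Z)) (2 * N)) => //.
apply/funext => i; rewrite /decode /=; case: ifPn => iN.
  by apply/esym/negbTE; exact: (hN i).1.
case: ifPn => Ni; first by rewrite (hN i).2.
rewrite nth_mkseq; last lia.
by congr z; lia.
Qed.

Lemma xi_config_Omega d (s : coupled_state d) : Omega (xi_config s).
Proof. exact: set_valP. Qed.

Lemma labels_Zplus d (s : coupled_state d) : Zplus d (labels s).
Proof. exact: set_valP. Qed.

Lemma coupled_state_inj d (s s' : coupled_state d) :
  xi_config s = xi_config s' -> labels s = labels s' -> s = s'.
Proof.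
by case: s s' => [z x] [z' x'];
  rewrite /xi_config /labels /= => /val_inj -> /val_inj ->.
Qed.

Definition mk_state d (z : config) (Oz : Omega z) (x : {ffun 'I_d -> int})
  (Zx : Zplus d x) : coupled_state d := (SigSub (mem_set Oz), SigSub (mem_set Zx)).

Lemma coupled_state_countable d : countable [set: coupled_state d].
Proof.
have /countable_injP[f finj] := Omega_countable.
apply/countable_injP; exists (fun s => pickle (f (xi_config s), labels s)).
move=> s s' _ _ /(pcan_inj pickleK)[/finj e1 e2]; apply: coupled_state_inj => //.
by apply: e1; rewrite inE; exact: xi_config_Omega.
Qed.

Lemma site_measurable (i : int) (b : bool) :
  measurable ([set z | z i = b] : set config_space).
Proof. by apply: sub_gen_smallest; exists i, b. Qed.

Lemma config_set1_measurable (z : config_space) : measurable [set z].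
Proof.
rewrite (_ : [set z] = \bigcap_k (if unpickle k is Some i then
    [set z' : config | z' i = z i] else setT)).
  apply: bigcapT_measurable => k; case: unpickle => [i|]; first exact: site_measurable.
  exact: measurableT.
apply/seteqP; split=> [z' -> k _|z' zz']; first by case: unpickle.
by apply/funext => i; have := zz' (pickle i) I; rewrite pickleK.
Qed.

Lemma sub_Omega_measurable (A : set config) : A `<=` Omega ->
  measurable (A : set config_space).
Proof.
move=> AO; apply: countable_measurable; first exact: config_set1_measurable.
exact: sub_countable (subset_card_le AO) Omega_countable.
Qed.

Section Summability.
Variables (R : realType) (q : R).
Hypothesis q01 : 0 < q < 1.

Let q0 : 0 < q. Proof. by case/andP: q01. Qed.
Let q1 : q < 1. Proof. by case/andP: q01. Qed.

Lemma esum_geometric_nat : (\esum_(k in [set: nat]) (q ^+ k)%:E <= ((1 - q)^-1)%:E)%E.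
Proof.
rewrite -nneseries_esumT; last by move=> k; rewrite lee_fin exprn_ge0// ltW.
apply: lime_le; first by apply: is_cvg_nneseries => k _ _;
  rewrite lee_fin exprn_ge0// ltW.
apply: nearW => k; rewrite sumEFin lee_fin.
have := @geometric_le_lim R k 1 q ler01 q0;
  rewrite ger0_norm ?(ltW q0)// mul1r => /(_ q1).
by apply: le_trans; rewrite le_eqVlt; apply/orP; left; apply/eqP/eq_bigr => i _;
  rewrite /geometric /= mul1r.
Qed.

Lemma esum_geometric_int : (\esum_(i in [set: int]) (q ^+ absz i)%:E < +oo)%E.
Proof.
have ge0 (i : int) : (0 <= (q ^+ absz i)%:E)%E by rewrite lee_fin exprn_ge0// ltW.
rewrite (esumID [set i : int | 0 <= i])// !setTI lte_add_pinfty//.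
  rewrite (_ : [set i : int | 0 <= i] = Posz @` setT); last first.
    by apply/seteqP; split=> [[k|k]//= _|_ [k _ <-]//]; exists k.
  rewrite esum_image; last by move=> x y _ _ [].
  exact: le_lt_trans esum_geometric_nat (ltry _).
rewrite (_ : ~` _ = Negz @` setT); last first.
  by apply/seteqP; split=> [[k|k]//= _|_ [k _ <-]//]; exists k.
rewrite esum_image; last by move=> x y _ _ [].
apply: le_lt_trans (ltry (1 - q)^-1); apply: le_trans esum_geometric_nat.
apply: le_esum => k _; rewrite lee_fin /= exprS ler_piMl ?exprn_ge0//; exact: ltW.
Qed.

Lemma esum_swap (I J : choiceType) (D : set I) (D' : set J) (a : I -> J -> \bar R) :
  (forall i j, (0 <= a i j)%E) ->
  (\esum_(i in D) \esum_(j in D') a i j = \esum_(j in D') \esum_(i in D) a i j)%E.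
Proof.
move=> a0; rewrite !esum_esum//.
rewrite (@reindex_esum _ _ _ (D' `*`` fun=> D) _ (fun k => (k.2, k.1)))//.
split=> [[s r] [/= ? ?]//|[s r] [s' r'] _ _ [-> ->]//|[s r] [/= ? ?]].
by exists (r, s).
Qed.

Variables (c : R) (mu : probability config_space R) (n : int).
Hypothesis hmu : is_product_blocking q c mu.

Definition site_weight (i : int) : R := q `^ (c - i%:~R).

Lemma site_weight_gt0 i : 0 < site_weight i.
Proof. exact: powR_gt0. Qed.

Lemma site_weightD (i : int) (k : nat) :
  site_weight i = site_weight (i + k%:Z) * q ^+ k.
Proof.
rewrite -powR_mulrn ?(ltW q0)// /site_weight -powRD; last by apply/implyP => _;
  rewrite gt_eqF.
by congr (_ `^ _); rewrite intrD -pmulrn; ring.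
Qed.

(** The bound is small far to the left, where the site weight decays geometrically; [hole_le] is its
    counterpart on the right. *)
Lemma particle_le i : (mu [set z | z i = true] <= (site_weight i)%:E)%E.
Proof.
rewrite hmu.1 lee_fin -/(site_weight i) ler_pdivrMr; last first.
  by rewrite ltr_wpDr// ?ltW// site_weight_gt0.
by rewrite mulrDr mulr1 lerDl mulr_ge0// ltW// site_weight_gt0.
Qed.

Lemma hole_le i : (mu [set z | z i = false] <= ((site_weight i)^-1)%:E)%E.
Proof.
have -> : [set z : config_space | z i = false] = ~` [set z | z i = true].
  by apply/seteqP; split=> z /=; case: (z i).
rewrite probability_setC; last exact: site_measurable.
rewrite hmu.1 -/(site_weight i) -EFinB lee_fin.
have a0 := site_weight_gt0 i; have a1 : 0 < 1 + site_weight i by rewrite addr_gt0.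
have -> : 1 - site_weight i / (1 + site_weight i) = (1 + site_weight i)^-1.
  by field; rewrite gt_eqF.
by rewrite lef_pV2 ?posrE// lerDr.
Qed.

Lemma conditional_particle_le (i : int) (b : bool) : 0 < fine (mu (level n)) ->
  blocking_cond mu n [set z | z i = b] <=
  fine (mu [set z | z i = b]) / fine (mu (level n)).
Proof.
move=> M0; rewrite /blocking_cond ler_pM2r ?invr_gt0//.
have mA : measurable ([set z | z i = b] `&` level n : set config_space).
  by apply: sub_Omega_measurable => z [_ []].
apply: fine_le; [exact: fin_num_measure|apply: fin_num_measure;
  exact: site_measurable|].
by apply: le_measure; [exact: mem_set|apply: mem_set;
  exact: site_measurable|exact: subIsetl].
Qed.

End Summability.

(** * The stationary law of the coupled system *)

Section StationaryLaw.
Variables (R : realType) (q : R).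
Hypothesis hq : 0 < q < 1.
Variables (d : nat) (n : int) (c : R) (mu : probability config_space R).
Hypothesis hmu : is_product_blocking q c mu.
Variables (disp : measure_display) (T : measurableType disp) (P : probability T R).
Variable Y : R -> T -> coupled_state d.
Hypothesis hY : markov_jump_process (@coupled_rate R q d) P Y.
Hypothesis hstat : stationary P Y.
Hypothesis hxi : forall A : set config,
  P [set w | A (xi_config (Y 0 w))] = (blocking_cond mu n A)%:E.

Let q0 : 0 < q. Proof. by case/andP: hq. Qed.
Let qn0 : q != 0. Proof. by rewrite gt_eqF. Qed.
Let M : R := fine (mu (level n)).

Lemma state_event_measurable (A : set (coupled_state d)) : measurable (Y 0 @^-1` A).
Proof. by case: hY => mY _ _; exact: mY. Qed.
Let mY0 := state_event_measurable.

(** If the level had mass 0, the quotient in [blocking_cond] would be 0 by the convention for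
    inverses, although the whole space has probability 1. *)
Lemma level_mass_gt0 : 0 < M.
Proof.
have : 0 <= M by exact: fine_ge0.
rewrite le_eqVlt => /orP[/eqP M0|//]; have := hxi setT.
rewrite /blocking_cond -/M -M0 invr0 mulr0 (_ : [set w | _] = setT)//.
by rewrite probability_setT => -[] /eqP; rewrite oner_eq0.
Qed.

(** Two unequal neighbours include a particle and a hole, so the event is bounded through whichever
    is rare there: a hole for [i >= 0], a particle for [i < 0]. *)
Lemma disagree_le : exists C : R, forall i : int,
  (P [set w | xi_config (Y 0%R w) i != xi_config (Y 0%R w) (i + 1)%R] <=
   (C * q ^+ absz i)%:E)%E.
Proof.
have M0 := level_mass_gt0; pose w0 := site_weight q c 0.
have w00 : 0 < w0 by exact: site_weight_gt0.
(* Relative to [q ^+ absz i], the two hole terms on the right are at most [1 / w0] each, and the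
   particle terms at [i] and [i + 1] on the left are [w0] and [w0 / q]. The factor [1 / M] comes
   from the conditioning. *)
exists ((w0 * (1 + q^-1) + 2 / w0) / M) => i.
have neq_or (x y b : bool) : x != y -> x = b \/ y = b.
  by case: x y b => -[] [] //; auto.
have two b : (P [set w | xi_config (Y 0%R w) i != xi_config (Y 0%R w) (i + 1)%R] <=
    ((fine (mu [set z | z i = b]) + fine (mu [set z | z (i + 1) = b])) / M)%:E)%E.
  pose F j := [set w | xi_config (Y 0 w) j = b].
  have mF j : measurable (F j) by exact: (mY0 [set s | xi_config s j = b]).
  have PF j : P (F j) = (blocking_cond mu n [set z | z j = b])%:E.
    exact: (hxi [set z | z j = b]).
  apply: (@le_trans _ _ (P (F i `|` F (i + 1)))).
    apply: le_measure; [apply: mem_set|apply: mem_set; exact: measurableU|].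
      exact: (mY0 [set s | xi_config s i != xi_config s (i + 1)]).
    by move=> w; exact: neq_or.
  apply: le_trans (measureU2 _ _ _) _ => //.
  rewrite mulrDl EFinD; apply: leeD.
    by rewrite [leLHS]PF lee_fin; exact: conditional_particle_le.
  by rewrite [leLHS]PF lee_fin; exact: conditional_particle_le.
have fle b j x : (mu [set z | z j = b] <= x%:E)%E -> fine (mu [set z | z j = b]) <= x.
  move=> h; have : mu [set z | z j = b] \is a fin_num.
    by apply: fin_num_measure; exact: site_measurable.
  by move=> /fineK e; rewrite -e lee_fin in h.
case: i two => k two.
  apply: le_trans (two false) _; rewrite lee_fin mulrAC ler_pM2r ?invr_gt0//.
  have e j : (site_weight q c j%:Z)^-1 = q ^+ j / w0.
    rewrite /w0 (site_weightD hq c 0 j) add0r.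
    have := site_weight_gt0 hq c j%:Z => h; field.
    by rewrite expf_neq0 ?gt_eqF.
  apply: (@le_trans _ _ (q ^+ k / w0 + q ^+ k / w0)).
    apply: lerD; first by rewrite -e; apply/fle/hole_le.
    apply: (@le_trans _ _ (q ^+ k.+1 / w0)).
      by rewrite -e; apply: fle; have := hole_le hq hmu k.+1%:Z; rewrite -addn1.
    rewrite ler_pM2r ?invr_gt0// exprS ler_piMl ?exprn_ge0// ltW//.
    by case/andP: hq.
  rewrite [leRHS]mulrDl [2 / w0 * _](_ : _ = q ^+ k / w0 + q ^+ k / w0) /=;
    last by ring.
  by rewrite lerDr mulr_ge0 ?exprn_ge0 ?mulr_ge0 ?addr_ge0 ?invr_ge0// ltW.
apply: le_trans (two true) _; rewrite lee_fin mulrAC ler_pM2r ?invr_gt0//.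
have e1 : site_weight q c (Negz k) = w0 * q ^+ k.+1.
  by rewrite (site_weightD hq c _ k.+1) NegzE addNr.
have e2 : site_weight q c (Negz k + 1) = w0 * q ^+ k.
  rewrite (site_weightD hq c _ k) NegzE; congr (site_weight q c _ * _); lia.
apply: (@le_trans _ _ (w0 * q ^+ k.+1 + w0 * q ^+ k)).
  by apply: lerD; [rewrite -e1|rewrite -e2]; apply/fle/particle_le.
rewrite mulrDl (_ : w0 * _ + _ = w0 * (1 + q^-1) * q ^+ k.+1); last first.
  by rewrite exprS; field.
by rewrite lerDl mulr_ge0 ?exprn_ge0 ?mulr_ge0 ?invr_ge0// ltW.
Qed.

Definition state_law (s : coupled_state d) : R := fine (P (Y 0 @^-1` [set s])).

Lemma state_law_ge0 s : 0 <= state_law s.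
Proof. exact: fine_ge0. Qed.

Lemma state_lawE s : P (Y 0 @^-1` [set s]) = (state_law s)%:E.
Proof. by rewrite fineK// fin_num_measure. Qed.

Lemma esum_state_law (A : set (coupled_state d)) :
  P (Y 0 @^-1` A) = (\esum_(s in A) (state_law s)%:E)%E.
Proof.
rewrite -[X in P X]setTI (@measure_countable_decomp _ _ _ _ _ _ _ setT)//.
- by rewrite setIT; apply: eq_esum => s _; rewrite setTI; exact: state_lawE.
- exact: coupled_state_countable.
- by move=> s; rewrite setTI.
Qed.

Lemma coupled_rate_ge0 s s' : 0 <= @coupled_rate R q d s s'.
Proof.
by rewrite addr_ge0// mulr_ge0 ?ler0n ?asep_rate_ge0 ?label_rate_ge0.
Qed.

(** Each site swap, and each move of one label up or down, leads to at most one state, so summing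
    over the targets counts it at most once. Label moves have rate at most 1, hence the term
    [2 d]. *)
Lemma total_rate_le (s : coupled_state d) :
  (\esum_(r in [set: coupled_state d]) (coupled_rate q s r)%:E <=
   \esum_(i in [set: int]) (jump_rate q (xi_config s) i)%:E + (d%:R *+ 2)%:E)%E.
Proof.
pose Q (r : coupled_state d) i :=
  (labels r == labels s) && (xi_config r == exchange (xi_config s) i).
pose up (r : coupled_state d) (j : 'I_d) :=
  (xi_config r == xi_config s) && (labels r == move (labels s) j (labels s j + 1)).
pose down (r : coupled_state d) (j : 'I_d) :=
  (xi_config r == xi_config s) && (labels r == move (labels s) j (labels s j - 1)).
have nat_and (a b : bool) : (a && b)%:R = a%:R * b%:R :> R.
  by case: a; case: b; rewrite /= ?mulr1 ?mul0r ?mulr0.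
have J0 i : 0 <= jump_rate q (xi_config s) i by exact: jump_rate_ge0.
apply: (@le_trans _ _ (\esum_(r in [set: coupled_state d])
    (\esum_(i in [set: int]) ((Q r i)%:R * jump_rate q (xi_config s) i)%:E +
     \sum_(j < d) (((up r j)%:R * 1)%:E + ((down r j)%:R * 1)%:E)))%E).
  apply: le_esum => r _; rewrite /coupled_rate EFinD; apply: leeD.
    rewrite EFinM; apply: (@le_trans _ _ (((labels r == labels s)%:R : R)%:E *
        \esum_(i in [set: int]) ((xi_config r == exchange (xi_config s) i)%:R *
          jump_rate q (xi_config s) i)%:E)%E).
      by apply: lee_wpmul2l; rewrite ?lee_fin//; exact: asep_rate_le.
    rewrite -esumZl//; last by move=> i; rewrite lee_fin mulr_ge0 ?ler0n ?J0.
    by apply: le_esum => i _; rewrite -EFinM lee_fin (nat_and (labels r == labels s))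
      mulrA.
  under eq_bigr do rewrite -EFinD; rewrite sumEFin lee_fin.
  apply: (@le_trans _ _ ((xi_config r == xi_config s)%:R *
     \sum_(j < d) ((labels r == move (labels s) j (labels s j + 1))%:R +
        (labels r == move (labels s) j (labels s j - 1))%:R))).
    by rewrite ler_wpM2l//; exact: label_rate_le.
  by rewrite mulr_sumr; apply: ler_sum => j _;
    rewrite !mulr1 !(nat_and (xi_config r == xi_config s)) mulrDr.
rewrite esumD; last 2 first.
- by move=> r _; apply: esum_ge0 => i _; rewrite lee_fin mulr_ge0 ?ler0n ?J0.
- by move=> r _; apply: sume_ge0 => j _; rewrite -EFinD lee_fin addr_ge0 ?mulr1.
apply: leeD.
  rewrite esum_swap; last by move=> r i; rewrite lee_fin mulr_ge0 ?ler0n ?J0.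
  apply: le_esum => i _; apply: esum_indicator_le => // r r' /andP[/eqP e1 /eqP e2]
    /andP[/eqP e3 /eqP e4].
  by apply: coupled_state_inj; rewrite ?e1 ?e2.
rewrite esum_sum; last by move=> r j _ _; rewrite -EFinD lee_fin addr_ge0 ?mulr1.
apply: (@le_trans _ _ (\sum_(j < d) (1%:E + 1%:E))%E); last first.
  by under eq_bigr do rewrite -EFinD;
    rewrite sumEFin lee_fin sumr_const card_ord mulrnDl mulr2n.
apply: lee_sum => j _; rewrite esumD; try by move=> r _; rewrite lee_fin mulr1.
apply: leeD; apply: esum_indicator_le => // r r' /andP[/eqP e1 /eqP e2] /andP[/eqP e3
  /eqP e4].
  by apply: coupled_state_inj; rewrite ?e1 ?e2.
by apply: coupled_state_inj; rewrite ?e1 ?e2.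
Qed.

(** The mean exit rate is at most [2 d] plus the sum over [i] of the probability that sites [i] and
    [i + 1] differ, and [disagree_le] bounds this sum by a geometric one. *)
Lemma flux_finite : (\esum_(s in [set: coupled_state d])
  \esum_(r in [set r | r != s]) (state_law s * coupled_rate q s r)%:E < +oo)%E.
Proof.
have [C hC] := disagree_le.
have L0 s : (0 <= (state_law s)%:E)%E by rewrite lee_fin state_law_ge0.
have total : (\esum_(s in [set: coupled_state d]) (state_law s)%:E = 1)%E.
  by rewrite -esum_state_law preimage_setT probability_setT.
have J0 s i : 0 <= jump_rate q (xi_config s) i by exact: jump_rate_ge0.
have LJ0 s i : (0 <= ((state_law s)%:E * (jump_rate q (xi_config s) i)%:E))%E.
  by rewrite mule_ge0// lee_fin.
apply: (@le_lt_trans _ _ (\esum_(s in [set: coupled_state d])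
   (\esum_(i in [set: int]) ((state_law s)%:E * (jump_rate q (xi_config s) i)%:E) +
    (d%:R *+ 2)%:E * (state_law s)%:E))%E).
  apply: le_esum => s _; under eq_esum do rewrite EFinM.
  rewrite [leLHS]esumZl; [|exact: state_law_ge0|by move=> r;
    rewrite lee_fin coupled_rate_ge0].
  rewrite esumZl; [|exact: state_law_ge0|by move=> i; rewrite lee_fin].
  rewrite [X in (_ + X)%E]muleC -ge0_muleDr; last 2 first.
  - by apply: esum_ge0 => i _; rewrite lee_fin.
  - by rewrite lee_fin mulrn_wge0.
  apply: lee_wpmul2l => //; apply: le_trans _ (total_rate_le s).
  rewrite [leRHS](esumID [set r | r != s]); last first.
    by move=> r _; rewrite lee_fin coupled_rate_ge0.
  by rewrite setTI leeDl// esum_ge0// => r _; rewrite lee_fin coupled_rate_ge0.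
rewrite esumD; last 2 first.
- by move=> s _; exact: esum_ge0.
- by move=> s _; rewrite mule_ge0// lee_fin mulrn_wge0.
rewrite esumZl ?mulrn_wge0// total lte_add_pinfty ?mule1 ?ltry//.
rewrite esum_swap//.
apply: (@le_lt_trans _ _ (\esum_(i in [set: int]) (C%:E * (q ^+ absz i)%:E))%E).
  apply: le_esum => i _; apply: le_trans (hC i).
  rewrite (esum_state_law [set s | xi_config s i != xi_config s (i + 1)]).
  rewrite [leRHS]esum_mkcond; apply: le_esum => s _.
  rewrite -EFinM; case: ifPn => [_|/negP].
    rewrite lee_fin ler_piMr ?state_law_ge0// (le_trans (jump_rate_le hq _ _))//.
    by case: (_ != _).
  rewrite inE /= => /negP; rewrite negbK => /eqP h.
  by rewrite jump_rate_eq0// mulr0.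
have C0 : 0 <= C.
  have := hC 0; rewrite /= expr0 mulr1 -lee_fin; apply: le_trans; exact: measure_ge0.
rewrite esumZl//; last by move=> i; rewrite lee_fin exprn_ge0// ltW.
by rewrite lte_mul_pinfty ?lee_fin// esum_geometric_int.
Qed.

Definition state_weight (s : coupled_state d) : R :=
  q ^ (inversions (xi_config s)) * q ^ (\sum_j labels s j).

Lemma state_weight_gt0 s : 0 < state_weight s.
Proof. by rewrite mulr_gt0// exprz_gt0. Qed.

Lemma coupled_reversible s s' :
  state_weight s * coupled_rate q s s' = state_weight s' * coupled_rate q s' s.
Proof.
rewrite /state_weight /coupled_rate !mulrDr; congr (_ + _).
  rewrite (eq_sym (labels s)); case: eqP => [->|_]; last by rewrite !mul0r !mulr0.
  have := asep_reversible hq (xi_config_Omega s) (xi_config_Omega s').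
  by rewrite !mul1r mulrAC => ->; rewrite mulrAC.
rewrite (eq_sym (xi_config s)); case: eqP => [->|_]; last by rewrite !mul0r !mulr0.
rewrite !mul1r -!mulrA; congr (_ * _).
by apply: label_reversible => //; exact: labels_Zplus.
Qed.

Lemma law_step s s' : s != s' -> 0 < coupled_rate q s s' ->
  state_law s / state_weight s = state_law s' / state_weight s'.
Proof.
move=> ss' rss'.
have := @reversible_unique R _ (@coupled_rate R q d) state_weight state_law
  coupled_rate_ge0 state_weight_gt0 coupled_reversible state_law_ge0
  (law_flux_le (coupled_state_countable d) coupled_rate_ge0 hY hstat) flux_finite
  s s' ss' rss'.
have := state_weight_gt0 s; have := state_weight_gt0 s' => h h' e.
by apply/eqP; rewrite eqr_div ?lt0r_neq0//; apply/eqP.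
Qed.

(** Jumps to the right lower [inversions] one by one, and [exists_descent] supplies such a jump
    until the step configuration is reached; the labels do not change. *)
Lemma law_to_ground s : height (xi_config s) = n ->
  state_law s / state_weight s =
  state_law (mk_state (ground_Omega n) (labels_Zplus s)) /
  state_weight (mk_state (ground_Omega n) (labels_Zplus s)).
Proof.
have [N] := ubnP (absz (inversions (xi_config s))); elim: N s => // N IH s sN hs.
have [e|ne] := pselect (xi_config s = ground n).
  by congr (state_law _ / state_weight _); apply: coupled_state_inj.
have Os := xi_config_Omega s.
have [i [zi zi1]] : exists i : int, xi_config s i /\ ~~ xi_config s (i + 1).
  by apply: (@exists_descent n).
pose s' := mk_state (exchange_Omega i Os) (labels_Zplus s).
have zne : xi_config s i != xi_config s (i + 1) by rewrite zi (negbTE zi1).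
rewrite (@law_step s s').
- rewrite IH; first by congr (state_law _ / state_weight _); exact: coupled_state_inj.
  + have := inversions_exchange Os zi zi1;
    have := inversions_ge0 (exchange (xi_config s) i).
    rewrite -[xi_config s']/(exchange (xi_config s) i); lia.
  + by rewrite -hs; exact: height_exchange.
- apply/eqP => /(congr1 (fun r => xi_config r i)).
  rewrite -[xi_config s' i]/(exchange (xi_config s) i i) /exchange eqxx.
  exact/eqP.
- rewrite /coupled_rate -[xi_config s']/(exchange (xi_config s) i).
  rewrite -[labels s']/(labels s) eqxx mul1r ltr_pwDl//.
    by rewrite asep_rate_exchange// jump_rate_gt0.
  by rewrite mulr_ge0// label_rate_ge0.
Qed.

(** In the step configuration consecutive labels sit on neighbouring sites, so [neighbours] forbids
    no label move. This is why the configuration is brought down before the labels. *)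
Lemma law_to_packed (x : {ffun 'I_d -> int}) (Zx : Zplus d x) :
  state_law (mk_state (ground_Omega n) Zx) / state_weight (mk_state (ground_Omega n)
    Zx) =
  state_law (mk_state (ground_Omega n) (packed_Zplus d)) /
  state_weight (mk_state (ground_Omega n) (packed_Zplus d)).
Proof.
have [N] := ubnP (absz (\sum_j x j)); elim: N x Zx => // N IH x Zx xN.
have [e|ne] := pselect (x = packed d).
  by congr (state_law _ / state_weight _); exact: coupled_state_inj.
have [j [xj0 xjc]] := exists_down_move Zx ne.
have Zx' := move_Zplus Zx xj0 xjc.
rewrite (@law_step _ (mk_state (ground_Omega n) Zx')).
- apply: IH; have := sum_move x j (x j - 1).
  have : 0 <= \sum_i (move x j (x j - 1)) i by apply: sumr_ge0 => i _; exact: Zx'.1.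
  lia.
- apply/eqP => /(congr1 (fun r => labels r j)).
  by rewrite /labels /= ffunE eqxx; lia.
- rewrite /coupled_rate.
  rewrite -[xi_config _]/(ground n) -[X in label_rate _ _ X]/x.
  rewrite -[X in label_rate _ _ _ X]/(move x j (x j - 1)) eqxx mul1r ltr_wpDl//.
    by rewrite mulr_ge0// asep_rate_ge0.
  apply: label_rate_gt0 => //; rewrite /neighbours !site_ground//; last exact: Zx.1.
  lia.
Qed.

Lemma law_off_level s : height (xi_config s) <> n -> state_law s = 0.
Proof.
move=> hs; have := hxi [set z | height z <> n].
rewrite /blocking_cond (_ : _ `&` level n = set0); last first.
  by apply/seteqP; split=> z // [? [_]].
rewrite measure0 mul0r => P0; apply/eqP; rewrite eq_le state_law_ge0 andbT.
rewrite -lee_fin -state_lawE -P0; apply: le_measure; rewrite ?inE //.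
- exact: (mY0 [set s | height (xi_config s) <> n]).
- by move=> w /= ->.
Qed.

Lemma law_product : exists K : R, forall (z : config) (x : {ffun 'I_d -> int})
    (Zx : Zplus d x) (Oz : Omega z), level n z ->
  state_law (mk_state Oz Zx) = K * q ^ (inversions z) * q ^ (\sum_j x j).
Proof.
exists (state_law (mk_state (ground_Omega n) (packed_Zplus d)) /
  state_weight (mk_state (ground_Omega n) (packed_Zplus d))) => z x Zx Oz [_ hz].
rewrite -(law_to_packed Zx) -mulrA.
have := @law_to_ground (mk_state Oz Zx) hz.
rewrite (_ : mk_state (ground_Omega n) (labels_Zplus (mk_state Oz Zx)) =
             mk_state (ground_Omega n) Zx); last exact: coupled_state_inj.
move=> <-; rewrite -[q ^ _ * q ^ _]/(state_weight (mk_state Oz Zx)).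
by rewrite mulfVK// gt_eqF// state_weight_gt0.
Qed.

End StationaryLaw.

(** * Labels of the second class particles *)

(* [avoid q d k] is the probability that the label k is missed by d second class
   particles: the label set has the law of d successive draws without
   replacement, each draw picking the free label of rank i with probability
   (1 - q) q^i; the recursion conditions on the first draw. *)
Fixpoint avoid (R : realType) (q : R) (d k : nat) : R :=
  if d is d'.+1 then (1 - q ^+ k) * avoid q d' k.-1 + q ^+ k.+1 * avoid q d' k
  else 1.

Lemma avoid0 (R : realType) (q : R) d : avoid q d 0 = q ^+ d.
Proof. by elim: d => //= d ->; rewrite expr0 expr1 exprS; ring. Qed.

(** The same probability conditioned on whether label 0 is taken, instead of on the first draw. This
    is the form that the label masses satisfy, while the defining recursion is the one that fits the
    series. *)
Lemma avoidS (R : realType) (q : R) d k : avoid q d.+1 k.+1 =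
  (1 - q ^+ d.+1) * avoid q d k + q ^+ d.+1 * avoid q d.+1 k.
Proof.
elim: d k => [|d IH] k; first by rewrite /= !exprS expr0; ring.
have E0 : avoid q d.+1 k = (1 - q ^+ k) * avoid q d k.-1 + q ^+ k.+1 * avoid q d k by
  [].
have E1 := IH k.
have -> : avoid q d.+2 k.+1 = (1 - q ^+ k.+1) * avoid q d.+1 k + q ^+ k.+2 * avoid q
  d.+1 k.+1 by [].
have -> : avoid q d.+2 k = (1 - q ^+ k) * avoid q d.+1 k.-1 + q ^+ k.+1 * avoid q
  d.+1 k by [].
rewrite E1; case: k E0 {E1} => [|k] E0.
  by rewrite [0.-1]/= !avoid0 !exprS expr0; ring.
have E2 := IH k; move: E0 E2; rewrite [k.+1.-1]/=.
set a := avoid q d.+1 k.+1; set b := avoid q d.+1 k; set e := avoid q d k.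
set f := avoid q d k.+1; rewrite !exprS; set Q := q ^+ d; set S := q ^+ k => E0 E2.
(* [E3], from the definition, eliminates [f], and [E4], from the induction hypothesis, eliminates
   [b]; a polynomial identity in [a] and [e] remains. *)
have E3 : q * (q * S) * f = a - (1 - q * S) * e by rewrite E0; ring.
have -> : (1 - q * (q * S)) * a + q * (q * (q * S)) * ((1 - q * Q) * f + q * Q * a) =
  (1 - q * (q * S)) * a + q * (1 - q * Q) * (q * (q * S) * f) + q * (q * (q * S)) *
    (q * Q * a).
  by ring.
rewrite E3 {E3 E0}.
have E4 : q * Q * b = a - (1 - q * Q) * e by rewrite E2; ring.
have -> : (1 - q * (q * Q)) * a + q * (q * Q) * ((1 - q * S) * b + q * (q * S) * a) =
  (1 - q * (q * Q)) * a + q * (1 - q * S) * (q * Q * b) + q * (q * Q) * (q * (q * S)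
    * a).
  by ring.
rewrite E4; ring.
Qed.

Section LabelMass.
Variables (R : realType) (q : R).
Hypothesis q01 : 0 < q < 1.

Let q0 : 0 < q. Proof. by case/andP: q01. Qed.
Let qn0 : q != 0. Proof. by rewrite gt_eqF. Qed.

(** The values are extended reals because finiteness of the total is deduced only later, from the
    normalisation of [P]. *)
Definition label_mass d (B : set {ffun 'I_d -> int}) : \bar R :=
  \esum_(x in B `&` Zplus d) (q ^ (\sum_j x j))%:E.

Lemma expz_ge0 (i : int) : (0 <= (q ^ i)%:E)%E.
Proof. by rewrite lee_fin ltW// exprz_gt0. Qed.

Lemma label_mass_ge0 d (B : set {ffun 'I_d -> int}) : (0 <= label_mass B)%E.
Proof. by apply: esum_ge0 => x _; exact: expz_ge0. Qed.

Lemma eq_label_mass d (B B' : set {ffun 'I_d -> int}) :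
  (forall x, Zplus d x -> B x <-> B' x) -> label_mass B = label_mass B'.
Proof.
move=> BB'; rewrite /label_mass; congr esum.
by apply/seteqP; split=> x [Bx Zx]; split=> //; apply/(BB' _ Zx).
Qed.

Definition cons0 d (x : {ffun 'I_d -> int}) : {ffun 'I_d.+1 -> int} :=
  [ffun j => if unlift ord0 j is Some i then x i + 1 else 0].

Definition shift_labels d (x : {ffun 'I_d -> int}) : {ffun 'I_d -> int} :=
  [ffun j => x j + 1].

Lemma cons0_0 d (x : {ffun 'I_d -> int}) : cons0 x ord0 = 0.
Proof. by rewrite ffunE unlift_none. Qed.

Lemma cons0_lift d (x : {ffun 'I_d -> int}) j : cons0 x (lift ord0 j) = x j + 1.
Proof. by rewrite ffunE liftK. Qed.

Lemma sum_shift_labels d (x : {ffun 'I_d -> int}) :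
  \sum_j shift_labels x j = \sum_j x j + d%:Z.
Proof.
under eq_bigr do rewrite ffunE.
by rewrite big_split /= sumr_const card_ord; congr (_ + _); rewrite natz.
Qed.

Lemma sum_cons0 d (x : {ffun 'I_d -> int}) : \sum_j cons0 x j = \sum_j x j + d%:Z.
Proof.
rewrite big_ord_recl cons0_0 add0r -sum_shift_labels.
by apply: eq_bigr => j _; rewrite cons0_lift ffunE.
Qed.

Lemma cons0_bij d (B : set {ffun 'I_d.+1 -> int}) :
  set_bij (@cons0 d @^-1` B `&` Zplus d)
    (B `&` Zplus d.+1 `&` [set x : {ffun _ -> int} | x ord0 = 0]) (@cons0 d).
Proof.
split=> [x [Bx [x0 xlt]]|x y _ _ e|x [[Bx [x0 xlt]] /= xo]].
- split; last exact: cons0_0; split=> //; split=> [j|i j].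
    case: (unliftP ord0 j) => [j' ->|->]; last by rewrite cons0_0.
    by rewrite cons0_lift addr_ge0.
  case: (unliftP ord0 j) => [j' ->|->] //; case: (unliftP ord0 i) => [i' ->|->].
    by rewrite !cons0_lift ltrD2r => ?; apply: xlt.
  by rewrite cons0_0 cons0_lift => _; rewrite ltr_wpDl.
- by apply/ffunP => j; apply: (@addIr _ (1 : int)); rewrite -!cons0_lift e.
- have e : cons0 [ffun j => x (lift ord0 j) - 1] = x.
    apply/ffunP => j; case: (unliftP ord0 j) => [j' ->|->]; last by rewrite cons0_0.
    by rewrite cons0_lift ffunE subrK.
  exists [ffun j => x (lift ord0 j) - 1] => //; split; first by rewrite /= e.
  split=> [j|i j ij]; rewrite !ffunE.
    by have := xlt ord0 (lift ord0 j) isT; rewrite xo; lia.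
  by rewrite ltrD2r; apply: xlt.
Qed.

Lemma shift_labels_bij d (B : set {ffun 'I_d.+1 -> int}) :
  set_bij (@shift_labels d.+1 @^-1` B `&` Zplus d.+1)
    (B `&` Zplus d.+1 `&` ~` [set x : {ffun _ ->
      int} | x ord0 = 0]) (@shift_labels d.+1).
Proof.
split=> [x [Bx [x0 xlt]]|x y _ _ e|x [[Bx [x0 xlt]] /= xo]].
- split; last by rewrite /= ffunE; have := x0 ord0; lia.
  split=> //; split=> [j|i j ij]; rewrite !ffunE.
    by rewrite addr_ge0.
  by rewrite ltrD2r; apply: xlt.
- apply/ffunP => j; apply: (@addIr _ (1 : int)).
  by have := congr1 (fun f : {ffun _} => f j) e; rewrite !ffunE.
- have e : shift_labels [ffun j => x j - 1] = x.
    by apply/ffunP => j; rewrite !ffunE subrK.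
  exists [ffun j => x j - 1] => //; split; first by rewrite /= e.
  split=> [j|i j ij]; rewrite !ffunE; last by rewrite ltrD2r; apply: xlt.
  have x1 : 0 < x ord0 by have := x0 ord0; lia.
  have : x ord0 <= x j.
    case: (unliftP ord0 j) => [j' ->|->//]; apply: ltW; exact: xlt.
  by lia.
Qed.

(** If label 0 is taken, it is removed and the other [d] labels move down by one; otherwise all
    [d + 1] labels do. The powers of [q] record the loss in the label sum. *)
Lemma label_mass_rec d (B : set {ffun 'I_d.+1 -> int}) :
  label_mass B = ((q ^+ d)%:E * label_mass (@cons0 d @^-1` B) +
                  (q ^+ d.+1)%:E * label_mass (@shift_labels d.+1 @^-1` B))%E.
Proof.
rewrite {1}/label_mass (esumID [set x : {ffun _ -> int} | x ord0 = 0]);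
  last by move=> *; exact: expz_ge0.
rewrite (reindex_esum _ _ _ _ (cons0_bij B)) (reindex_esum _ _ _ _ (shift_labels_bij
  B)).
congr (_ + _)%E.
  rewrite /label_mass -esumZl ?exprn_ge0 ?ltW//; last by move=> *; exact: expz_ge0.
  by apply: eq_esum => x _; rewrite sum_cons0 expfzDr// mulrC EFinM.
rewrite /label_mass -esumZl ?exprn_ge0 ?ltW//; last by move=> *; exact: expz_ge0.
by apply: eq_esum => x _; rewrite sum_shift_labels expfzDr// mulrC EFinM.
Qed.

(** Both cases of [label_mass_rec] lower a missed label [k + 1] to [k]. Applied to the full space,
    that recursion shows that label 0 is taken with probability [1 - q ^+ d.+1], and the result is
    the recursion [avoidS]. *)
Lemma avoid_mass d (k : nat) : (label_mass [set: {ffun 'I_d -> int}] < +oo)%E ->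
  label_mass [set x : {ffun 'I_d -> int} | k%:Z \notin codom x] =
  ((avoid q d k)%:E * label_mass [set: {ffun 'I_d -> int}])%E.
Proof.
elim: d k => [|d IH] k Zfin.
  rewrite mul1e; apply: eq_label_mass => x _; split=> // _.
  by apply/negP => /codomP[[]].
set Z := label_mass setT in Zfin *.
have Zrec : Z = ((q ^+ d)%:E * label_mass [set: {ffun 'I_d ->
  int}] + (q ^+ d.+1)%:E * Z)%E.
  by rewrite {1}/Z label_mass_rec !preimage_setT.
have Z0 : (0 <= Z)%E by exact: label_mass_ge0.
have Zf : Z \is a fin_num by rewrite ge0_fin_numE.
have qd0 : 0 < q ^+ d by rewrite exprn_gt0.
have Zd0 := label_mass_ge0 [set: {ffun 'I_d -> int}].
have Zdfin : (label_mass [set: {ffun 'I_d -> int}] < +oo)%E.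
  rewrite ltey; apply/eqP => e; move: Zrec; rewrite e mulry gtr0_sg// mul1e addye//.
    by move=> Zoo; rewrite Zoo ltxx in Zfin.
  by rewrite -(fineK Zf) -EFinM.
have Zdf : label_mass [set: {ffun 'I_d -> int}] \is a fin_num by rewrite ge0_fin_numE.
have Zd : q ^+ d * fine (label_mass [set: {ffun 'I_d ->
  int}]) = (1 - q ^+ d.+1) * fine Z.
  have := congr1 fine Zrec; rewrite fineD ?fin_numM// !fineM// => e.
  by rewrite mulrBl mul1r {1}e addrK.
rewrite -(fineK Zf); elim: k => [|k IHk].
  (* Every vector built by [cons0] contains label 0 and drops out; no vector built by [shift_labels]
     does. *)
  rewrite label_mass_rec [X in (_ * X + _)%E](_ : _ = 0%E); last first.
    rewrite /label_mass esum1// => x [/= h _]; exfalso; move/negP: h; apply.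
    by apply/codomP; exists ord0; rewrite cons0_0.
  rewrite mule0 add0e avoid0 (fineK Zf); congr (_ * _)%E.
  apply: eq_label_mass => x [x0 _]; split=> // _.
  apply/negP => /codomP[j]; rewrite ffunE; have := x0 j; lia.
rewrite label_mass_rec.
rewrite (_ : @cons0 d @^-1` _ = [set x | k%:Z \notin codom x]); last first.
  apply/seteqP; split=> x /=; apply: contraNN => /codomP[j xj]; apply/codomP.
    by exists (lift ord0 j); rewrite cons0_lift -xj; lia.
  move: xj; case: (unliftP ord0 j) => [j' ->|->]; last by rewrite cons0_0.
  by rewrite cons0_lift => xj; exists j'; lia.
rewrite (_ : @shift_labels d.+1 @^-1` _ = [set x | k%:Z \notin codom x]); last first.
  apply/seteqP; split=> x /=; apply: contraNN => /codomP[j xj]; apply/codomP.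
    by exists j; rewrite ffunE -xj; lia.
  by exists j; move: xj; rewrite ffunE; lia.
rewrite IH// IHk -(fineK Zdf) -!EFinM -EFinD avoidS; congr EFin.
by rewrite mulrCA Zd; ring.
Qed.

End LabelMass.

(** * Occupation probabilities *)

(** The factor may be infinite: [joint_mass] pulls out a label mass whose finiteness is itself a
    consequence of [joint_mass]. *)
Lemma ge0_esumZl (R : realType) (I : choiceType) (D : set I) (a : I -> \bar R)
    (r : \bar R) : (0 <= r)%E -> (forall i, (0 <= a i)%E) ->
  (\esum_(i in D) (r * a i) = r * \esum_(i in D) a i)%E.
Proof.
case: r => [r r0 h|_ h|//]; first exact: esumZl.
have [z|/existsNP[i /not_implyP[Di ai]]] := pselect (forall i, D i -> a i = 0%E).
  by rewrite !esum1 ?mule0// => i /z ->; rewrite mule0.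
have ap : (0 < a i)%E by rewrite lt_def h andbT; apply/eqP.
have ge (b : I -> \bar R) : (b i <= \esum_(j in D) b j)%E.
  by apply: esum_ge; exists [set i]; [split=> // _ ->|rewrite fsbig_set1].
rewrite [RHS]gt0_mulye; last exact: lt_le_trans ap (ge a).
by apply/eqP; rewrite -leye_eq -[leLHS](gt0_mulye ap);
  exact: (ge (fun j => +oo * a j)%E).
Qed.

Section JointLaw.
Variables (R : realType) (q : R).
Hypothesis hq : 0 < q < 1.
Variables (d : nat) (n : int).
Variables (disp : measure_display) (T : measurableType disp) (P : probability T R).
Variables (Y0 : T -> coupled_state d) (L : coupled_state d -> R) (K : R).
Hypothesis mY0 : forall A : set (coupled_state d), measurable (Y0 @^-1` A).
Hypothesis L_ge0 : forall s, 0 <= L s.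
Hypothesis law : forall A : set (coupled_state d),
  P (Y0 @^-1` A) = (\esum_(s in A) (L s)%:E)%E.
Hypothesis law_on : forall (z : config) (x : {ffun 'I_d -> int}) (Zx : Zplus d x)
  (Oz : Omega z), level n z ->
    L (mk_state Oz Zx) = K * q ^ (inversions z) * q ^ (\sum_j x j).
Hypothesis law_off : forall s, height (xi_config s) <> n -> L s = 0.

Let q0 : 0 < q. Proof. by case/andP: hq. Qed.
Let q1 : q < 1. Proof. by case/andP: hq. Qed.
Let qn0 : q != 0. Proof. by rewrite gt_eqF. Qed.

Definition config_mass (A : set config) : \bar R :=
  \esum_(z in A `&` level n) (q ^ (inversions z))%:E.

Lemma config_mass_ge0 A : (0 <= config_mass A)%E.
Proof. by apply: esum_ge0 => z _; exact: expz_ge0. Qed.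

Lemma constant_ge0 : 0 <= K.
Proof.
have gl : level n (ground n) by split; [exact: ground_Omega|exact: height_ground].
have := L_ge0 (mk_state (ground_Omega n) (packed_Zplus d)).
by rewrite law_on// !pmulr_lge0// exprz_gt0.
Qed.

Definition joint_event (A : set config) (B : set {ffun 'I_d -> int}) : set T :=
  Y0 @^-1` [set s | A (xi_config s) /\ B (labels s)].

Lemma joint_mass A B :
  P (joint_event A B) = (K%:E * config_mass A * label_mass q B)%E.
Proof.
set E := [set s | A (xi_config s) /\ B (labels s)].
have -> : P (joint_event A B) =
    (\esum_(s in E `&` [set s | height (xi_config s) = n]) (L s)%:E)%E.
  rewrite /joint_event law [RHS]esum_mkcondr; apply: eq_esum => s _.
  by case: ifPn => // /negP; rewrite inE => /law_off ->.
pose D := (A `&` level n) `*`` (fun _ : config => B `&` Zplus d).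
pose f (k : config * {ffun 'I_d ->
  int}) := (K * q ^ (inversions k.1) * q ^ (\sum_j k.2 j))%:E.
transitivity (\esum_(k in D) f k)%E.
  rewrite (@reindex_esum _ _ _ (E `&` [set s | height (xi_config s) = n]) D
     (fun s => (xi_config s, labels s))).
    apply: eq_esum => s [_ hs]; rewrite /f /=.
    have Os := xi_config_Omega s; have Zs := labels_Zplus s.
    rewrite -(law_on Zs Os) //; congr ((L _)%:E).
    exact: coupled_state_inj.
  split=> [s [[As Bs] hs]|s s' _ _ [e1 e2]|[z x] [[Az lz] [Bx Zx]]].
  - split; first by split=> //; split=> //; exact: xi_config_Omega.
    by split=> //; exact: labels_Zplus.
  - exact: coupled_state_inj.
  - by exists (mk_state lz.1 Zx) => //; split; [split|exact: lz.2].
rewrite -(@esum_esum _ _ _ _ (fun _ => B `&` Zplus d)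
   (fun z x => (K * q ^ (inversions z) * q ^ (\sum_j x j))%:E)); last first.
  move=> z x _ _; rewrite lee_fin !mulr_ge0 ?constant_ge0//; apply: ltW;
    exact: exprz_gt0.
transitivity (\esum_(z in A `&` level n) ((K%:E * label_mass q B) * (q ^ (inversions
  z))%:E))%E.
  apply: eq_esum => z _; under eq_esum do rewrite EFinM.
  rewrite esumZl; last 2 first.
  - by rewrite mulr_ge0 ?constant_ge0// ltW// exprz_gt0.
  - by move=> x; exact: expz_ge0.
  by rewrite EFinM muleAC.
rewrite ge0_esumZl; first by rewrite muleAC.
- by rewrite mule_ge0 ?lee_fin ?constant_ge0 ?label_mass_ge0.
- by move=> z; exact: expz_ge0.
Qed.

Lemma total_mass :
  (K%:E * config_mass setT * label_mass q [set: {ffun 'I_d -> int}] = 1)%E.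
Proof.
by rewrite -joint_mass -(probability_setT P); congr (P _); apply/seteqP.
Qed.

(** An infinite factor would turn the product in [total_mass] into 0 or infinity instead of 1. *)
Lemma label_mass_lty : (label_mass q [set: {ffun 'I_d -> int}] < +oo)%E.
Proof.
rewrite ltey; apply/eqP => e; have := total_mass; rewrite e.
have : (0 <= K%:E * config_mass setT)%E.
  by rewrite mule_ge0 ?config_mass_ge0 ?lee_fin ?constant_ge0.
by rewrite le_eqVlt => /orP[/eqP <-|/gt0_muley->//]; rewrite mul0e => -[] /esym/eqP;
  rewrite oner_eq0.
Qed.

Definition occupation (A : set config) : R := fine (P (joint_event A setT)).

Lemma occE A : P (joint_event A setT) = (occupation A)%:E.
Proof. by rewrite fineK// fin_num_measure//; exact: mY0. Qed.

Lemma occupation_mass A : (K%:E * config_mass A * label_mass q [set: {ffun 'I_d ->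
  int}])%E = (occupation A)%:E.
Proof. by rewrite -joint_mass occE. Qed.

Lemma occupation_scale A B (r : R) : config_mass A = (r%:E * config_mass B)%E ->
  occupation A = r * occupation B.
Proof.
move=> e; apply: EFin_inj; rewrite EFinM -!occupation_mass e.
by rewrite !muleA [(K%:E * _)%E]muleC.
Qed.

Lemma occupation_event A B : (forall z, Omega z -> A z <-> B z) ->
  occupation A = occupation B.
Proof.
move=> AB; congr (fine (P _)); apply/seteqP.
by split=> w [/= /(AB _ (xi_config_Omega _)) ? ?]; split.
Qed.

Lemma occupation_split A (p : pred config) :
  occupation A = occupation [set z | A z /\ p z] + occupation [set z | A z /\ ~~ p z].
Proof.
apply: EFin_inj; rewrite EFinD -!occE -measureU; last 3 first.
- exact: mY0.
- exact: mY0.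
- by apply/seteqP; split=> w // [[[_ /= h] _] [[_ /negP]]].
congr (P _); apply/seteqP; split=> w /=; rewrite /joint_event /=.
  by move=> [Aw _]; case: (boolP (p (xi_config (Y0 w)))) => h; [left|right].
by move=> [[[? _] _]|[[? _] _]].
Qed.

Lemma level_holes z m : level n z -> holes z m = n - m + 1 + label z m.
Proof. by move=> [Oz /= hz]; have := holesB m Oz; rewrite hz; lia. Qed.

(** [rshift m] maps the configurations with [k] particles left of [m] bijectively onto those that
    moreover have a particle at [m]; on level [n] it creates [n - m + 1 + k] inversions. *)
Lemma occupation_rshift (m k : int) : occupation [set z | label z m = k /\ z m] =
  q ^ (n - m + 1 + k) * occupation [set z | label z m = k].
Proof.
apply: occupation_scale; rewrite /config_mass.
rewrite (@reindex_esum _ _ _ ([set z | label z m = k] `&` level n) _ (rshift m)).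
  rewrite -esumZl; last 2 first.
  - by rewrite ltW// exprz_gt0.
  - by move=> z; exact: expz_ge0.
  apply: eq_esum => z [/= lz nz]; rewrite inversions_rshift; last exact: nz.1.
  by rewrite (level_holes m nz) lz expfzDr// mulrC EFinM.
split=> [z [/= lz [Oz hz]]|z z' _ _ e|z [[/= lz zm] [Oz hz]]].
- split; last by split; [exact: rshift_Omega|rewrite /= height_rshift].
  by rewrite /= label_rshift// lexx /rshift ltxx eqxx.
- apply/funext => i; have [im|mi] := ltP i m.
    by have := congr1 (fun f : config => f i) e; rewrite /rshift im.
  have := congr1 (fun f : config => f (i + 1)) e; rewrite /rshift addrK.
  rewrite (_ : (i + 1 < m) = false); last lia.
  by rewrite (_ : (i + 1 == m) = false) //; lia.
(* The inverse deletes site [m] and closes the gap from the right. *)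
- pose z' : config := fun i => if i < m then z i else z (i + 1).
  have Oz' : Omega z'.
    have /OmegaP[N hN] := Oz; apply/OmegaP; exists (N + absz m).+1 => i; rewrite /z'.
    by split=> hi; case: ifP => h;
      [apply: (hN _).1| |apply: (hN _).2|apply: (hN _).2]; lia.
  have e : rshift m z' = z.
    apply/funext => i; rewrite /rshift /z'; have [//|im] := ltP i m.
    have [->|ne] := eqVneq i m; first by rewrite zm.
    rewrite ifF; last lia.
    by rewrite subrK.
  exists z' => //; split; last first.
    by split=> //; rewrite /= -(height_rshift m Oz') e.
  by rewrite /= -lz -e label_rshift// lexx.
Qed.

Lemma occupation_lshift (m k : int) :
  occupation [set z | label z (m + 1) = k /\ ~~ z m] =
  q ^ k * occupation [set z | label z (m + 1) = k].
Proof.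
apply: occupation_scale; rewrite /config_mass.
rewrite (@reindex_esum _ _ _ ([set z | label z (m + 1) = k] `&` level n) _ (lshift m)).
  rewrite -esumZl; last 2 first.
  - by rewrite ltW// exprz_gt0.
  - by move=> z; exact: expz_ge0.
  apply: eq_esum => z [/= lz nz]; rewrite inversions_lshift; last exact: nz.1.
  by rewrite lz expfzDr// mulrC EFinM.
split=> [z [/= lz [Oz hz]]|z z' _ _ e|z [[/= lz zm] [Oz hz]]].
- split; last by split; [exact: lshift_Omega|rewrite /= height_lshift].
  by rewrite /= label_lshift// /lshift ltxx eqxx ifF//; lia.
- apply/funext => i; have [im|mi] := leP i m.
    have := congr1 (fun f : config => f (i - 1)) e; rewrite /lshift subrK.
    by rewrite (_ : i - 1 < m) //; lia.
  have := congr1 (fun f : config => f i) e; rewrite /lshift.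
  rewrite (_ : (i < m) = false); last lia.
  by rewrite (_ : (i == m) = false) //; lia.
- pose z' : config := fun i => if i <= m then z (i - 1) else z i.
  have Oz' : Omega z'.
    have /OmegaP[N hN] := Oz; apply/OmegaP; exists (N + absz m).+1 => i; rewrite /z'.
    by split=> hi; case: ifP => h;
      [apply: (hN _).1|apply: (hN _).1|apply: (hN _).2|apply: (hN _).2]; lia.
  have e : lshift m z' = z.
    apply/funext => i; rewrite /lshift /z'; case: ifP => im.
      by rewrite (_ : i + 1 <= m) ?addrK//; lia.
    have [->|ne] := eqVneq i m; first by rewrite (negbTE zm).
    by rewrite ifF//; lia.
  exists z' => //; split; last first.
    by split=> //; rewrite /= -(height_lshift m Oz') e.
  by rewrite /= -lz -e label_lshift// ifF//; lia.
Qed.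

(** Both sides are the probability that [m] is empty with [k] particles to its left, obtained as a
    complement through [occupation_rshift] and directly through [occupation_lshift]. *)
Lemma occupation_label_stepR (m k : int) :
  (1 - q ^ (n - m + 1 + k)) * occupation [set z | label z m = k] =
  q ^ k * occupation [set z | label z (m + 1) = k].
Proof.
rewrite -occupation_lshift mulrBl mul1r -occupation_rshift.
have /= -> := occupation_split [set z | label z m = k] (fun z => z m).
rewrite [X in X - _]addrC addrK; apply: occupation_event => z Oz /=; rewrite labelS//.
by case: (z m) => /=; split=> -[]//; rewrite addr0.
Qed.

(** Both sides are the probability that [m] is occupied with [k] particles to its left; the two
    shifts exchange their roles. *)
Lemma occupation_label_stepL (m k : int) :
  (1 - q ^ (k + 1)) * occupation [set z | label z (m + 1) = k + 1] =
  q ^ (n - m + 1 + k) * occupation [set z | label z m = k].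
Proof.
rewrite -occupation_rshift mulrBl mul1r -occupation_lshift.
have /= -> := occupation_split [set z | label z (m + 1) = k + 1] (fun z => z m).
rewrite addrK.
apply: occupation_event => z Oz /=; rewrite labelS//.
by case: (z m) => /=; split=> -[]//; [move/addIr|move=> ->].
Qed.

(* On level n, having k particles to the left of the site n + 1 + k - l amounts to
   having l holes at or to the right of it. *)
Definition beta (k l : nat) :
  R := occupation [set z | label z (n + 1 + k%:Z - l%:Z) = k%:Z].

Lemma betaSl k l : (1 - q ^+ l.+1) * beta k l.+1 = q ^+ k * beta k l.
Proof.
have := occupation_label_stepR (n + 1 + k%:Z - l.+1%:Z) k%:Z.
have -> : n - (n + 1 + k%:Z - l.+1%:Z) + 1 + k%:Z = l.+1%:Z by lia.
by have -> : n + 1 + k%:Z - l.+1%:Z + 1 = n + 1 + k%:Z - l%:Z by lia.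
Qed.

Lemma betaSk k l : (1 - q ^+ k.+1) * beta k.+1 l = q ^+ l * beta k l.
Proof.
have := occupation_label_stepL (n + 1 + k%:Z - l%:Z) k%:Z.
have -> : n - (n + 1 + k%:Z - l%:Z) + 1 + k%:Z = l%:Z by lia.
have -> : n + 1 + k%:Z - l%:Z + 1 = n + 1 + k.+1%:Z - l%:Z by lia.
by have -> : k%:Z + 1 = k.+1%:Z by lia.
Qed.

Lemma one_sub_gt0 k : 0 < 1 - q ^+ k.+1.
Proof. by rewrite subr_gt0 exprn_ilt1// ltW. Qed.

Lemma qpochS k : qpoch q k.+1 = qpoch q k * (1 - q ^+ k.+1).
Proof. by rewrite /qpoch big_nat_recr. Qed.

Lemma qpoch0 : qpoch q 0 = 1.
Proof. by rewrite /qpoch big_geq. Qed.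

Lemma qpoch_gt0 k : 0 < qpoch q k.
Proof.
by elim: k => [|k IH]; rewrite ?qpoch0// qpochS mulr_gt0// one_sub_gt0.
Qed.

Lemma betaE k l : beta k l = q ^+ (k * l) / (qpoch q k * qpoch q l) * beta 0 0.
Proof.
elim: k => [|k IH].
  elim: l => [|l IH]; first by rewrite muln0 qpoch0 mulr1 divr1 mul1r.
  apply: (@mulfI _ (1 - q ^+ l.+1)); first by rewrite gt_eqF ?one_sub_gt0.
  rewrite betaSl IH qpochS qpoch0 !mul0n expr0; field.
  by rewrite !gt_eqF ?qpoch_gt0 ?one_sub_gt0.
apply: (@mulfI _ (1 - q ^+ k.+1)); first by rewrite gt_eqF ?one_sub_gt0.
rewrite betaSk IH qpochS mulSn exprD; field.
by rewrite !gt_eqF ?qpoch_gt0 ?one_sub_gt0.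
Qed.

(** Every configuration in [Omega] is empty far to the left, so the increasing events of having no
    particle left of [n + 1 - l] exhaust the space. *)
Lemma beta_cvg : beta 0 l @[l --> \oo] --> (1 : R).
Proof.
pose F l := joint_event [set z | label z (n + 1 + 0%:Z - l%:Z) = 0] setT.
have FU : \bigcup_l F l = setT.
  apply/seteqP; split=> // w _; have [a za] := Omega_left (xi_config_Omega (Y0 w)).
  exists (absz (n + 1 - a)%R) => //; split=> //=; apply: label0 => k hk; apply: za; lia.
have Fmono : nondecreasing_seq F.
  move=> i j ij; apply/subsetPset => w [/= h _]; split=> //=; apply/eqP.
  rewrite eq_le label_ge0 andbT -h; apply: label_le; first exact: xi_config_Omega.
  lia.
have mF l : measurable (F l) by exact: mY0.
have : P \o F @ \oo --> 1%E.
  rewrite -(probability_setT P) -FU; apply: nondecreasing_cvg_mu => //.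
  exact: bigcupT_measurable.
by move=> /fine_cvgP[_].
Qed.

Lemma beta00_neq0 : beta 0 0 != 0.
Proof.
apply/eqP => b0; have := beta_cvg.
rewrite (_ : (fun l => beta 0 l) = (fun=> 0)); last first.
  by apply/funext => l; rewrite betaE b0 mulr0.
move=> /(cvg_lim (@Rhausdorff R)); rewrite lim_cst; last exact: Rhausdorff.
by move=> /eqP; rewrite eq_sym oner_eq0.
Qed.

(** [beta 0 l] equals [beta 0 0 / qpoch q l] and tends to 1. This identifies the unknown constant
    [beta 0 0] and proves at the same time that the products converge. *)
Lemma qpoch_cvg : qpoch q l @[l --> \oo] --> beta 0 0.
Proof.
have b00 := beta00_neq0.
have -> : (fun l => qpoch q l) = (fun l => beta 0 0 * (beta 0 l)^-1).
  apply/funext => l; rewrite (betaE 0 l) mul0n expr0 qpoch0; field.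
  by rewrite b00 gt_eqF ?qpoch_gt0.
have : beta 0 0 * (beta 0 l)^-1 @[l --> \oo] --> beta 0 0 * (1 : R)^-1.
  by apply: cvgMl_tmp; apply: cvgV; [exact: oner_neq0|exact: beta_cvg].
by rewrite invr1 mulr1.
Qed.

Lemma qpoch_inf_beta : qpoch_inf q = beta 0 0.
Proof. exact/cvg_lim/qpoch_cvg. Qed.

Lemma qpoch_inf_neq0 : qpoch_inf q != 0.
Proof. by rewrite qpoch_inf_beta beta00_neq0. Qed.

(* The k-th summand of the formula, with s = n - m + 1, extended by 0 to the
   indices k < - s. *)
Definition summand (s : int) (k : nat) : R :=
  if 0 <= s + k%:Z
  then q ^ ((k%:Z + 1) * (s + k%:Z)) / (qpoch q k * qpoch q (absz (s + k%:Z))) else 0.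

Lemma summand_ge0 s k : 0 <= summand s k.
Proof.
rewrite /summand; case: ifP => // _.
by rewrite divr_ge0 ?mulr_ge0// ltW ?exprz_gt0 ?qpoch_gt0.
Qed.

Lemma occupation_particle (m : int) (k : nat) :
  occupation [set z | label z m = k%:Z /\ z m] = qpoch_inf q * summand (n - m + 1) k.
Proof.
rewrite occupation_rshift /summand; case: ifPn => [l0|/negP l0]; last first.
  rewrite mulr0 (_ : occupation _ = 0) ?mulr0//; apply: EFin_inj;
    rewrite -occupation_mass.
  rewrite /config_mass esum1 ?mule0 ?mul0e// => z [/= lz nz]; exfalso; apply: l0.
  by rewrite -lz -level_holes// holes_ge0.
pose l := absz (n - m + 1 + k%:Z); have e : n - m + 1 + k%:Z = l%:Z by rewrite /l; lia.
have -> : occupation [set z | label z m = k%:Z] = beta k l.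
  by rewrite /beta; have -> : n + 1 + k%:Z - l%:Z = m by lia.
rewrite e betaE -qpoch_inf_beta /=.
have -> : (k%:Z + 1) * l%:Z = (l + k * l)%N%:Z by lia.
rewrite -[q ^ l%:Z]/(q ^+ l) -[q ^ (l + k * l)%N%:Z]/(q ^+ (l + k * l)) exprD.
by ring.
Qed.

(** With [l = s + k] and the common factor [summand (s + 1) k] taken out, the two terms on the left
    contribute [q ^+ l.+1] and [1 - q ^+ l.+1]. *)
Lemma summand_rec (s : int) (k : nat) :
  summand s k.+1 * (1 - q ^+ k.+1) + summand s k * q ^+ k.+1 = summand (s + 1) k.
Proof.
rewrite /summand; have e : s + k.+1%:Z = s + 1 + k%:Z by lia.
rewrite e; have [h|h] := leP 0 (s + 1 + k%:Z); last by rewrite ifF ?mul0r ?addr0//; lia.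
have qp := gt_eqF (qpoch_gt0 _); have os := gt_eqF (one_sub_gt0 _).
(* In the boundary case [s + k = -1] the second term vanishes by the extension of [summand], and the
   exponents in the other two are 0. *)
have [h'|h'] := leP 0 (s + k%:Z); last first.
  have -> : s + 1 + k%:Z = 0 by lia.
  by rewrite !mulr0 !expr0z qpochS qpoch0 mul0r addr0; field; rewrite qp os.
pose l := absz (s + k%:Z); have el : s + k%:Z = l%:Z by rewrite /l; lia.
have -> : s + 1 + k%:Z = l.+1%:Z by lia.
rewrite el /= !qpochS.
have -> : (k.+1%:Z + 1) * l.+1%:Z = (k.+1 * l + l + k.+2)%N%:Z by lia.
have -> : (k%:Z + 1) * l%:Z = (k.+1 * l)%N%:Z by lia.
have -> : (k%:Z + 1) * l.+1%:Z = (k.+1 * l + k.+1)%N%:Z by lia.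
rewrite -!exprnP !exprD [q ^+ k.+2]exprS.
set A := q ^+ (k.+1 * l); rewrite [q ^+ l.+1]exprS.
field.
by rewrite -exprS !qp !os.
Qed.

(** The label [k] of the particle at [m] splits the event into disjoint pieces, and by independence
    the constraint [B k] on the label vector multiplies each piece by [r k]. *)
Lemma summand_series (B : nat -> set {ffun 'I_d -> int}) (r : nat -> R) (m : int) :
  (forall k, 0 <= r k) ->
  (forall k, label_mass q (B k) = ((r k)%:E * label_mass q [set: {ffun 'I_d ->
    int}])%E) ->
  P (\bigcup_k joint_event [set z | label z m = k%:Z /\ z m] (B k)) =
  (\sum_(k <oo) ((qpoch_inf q)%:E * (summand (n - m + 1) k * r k)%:E))%E.
Proof.
move=> r0 Br; have mF k : measurable (joint_event [set z |
   label z m = k%:Z /\ z m] (B k)).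
  exact: mY0.
rewrite measure_semi_bigcup//; last first.
- exact: bigcupT_measurable.
- by move=> i j _ _ [w [[[/= li _] _] [[lj _] _]]]; move: li; rewrite lj => -[].
apply: eq_eseriesr => k _;
  rewrite [LHS]joint_mass Br muleCA occupation_mass occupation_particle.
by rewrite -!EFinM; congr EFin; ring.
Qed.

End JointLaw.

(** * The two series *)

Section AvoidSeries.
Variables (R : realType) (q : R).
Hypothesis hq : 0 < q < 1.

Let q0 : 0 < q. Proof. by case/andP: hq. Qed.
Let q1 : q < 1. Proof. by case/andP: hq. Qed.

Lemma one_sub_ge0 k : 0 <= 1 - q ^+ k.
Proof. by rewrite subr_ge0 exprn_ile1// ltW. Qed.

Lemma avoid_ge0 d k : 0 <= avoid q d k.
Proof.
elim: d k => //= d IH k.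
by rewrite addr_ge0 ?mulr_ge0 ?one_sub_ge0 ?exprn_ge0// ltW.
Qed.

Lemma avoid_series d (s : int) :
  (\sum_(k <oo) (summand q s k * avoid q d k)%:E =
   \sum_(k <oo) (summand q (s + d%:Z) k)%:E)%E.
Proof.
have qk0 k : 0 <= q ^+ k by rewrite exprn_ge0// ltW.
elim: d s => [|d IH] s.
  by apply: eq_eseriesr => k _; rewrite /= mulr1 addr0.
pose f k := summand q s k * (1 - q ^+ k) * avoid q d k.-1.
pose g k := summand q s k * q ^+ k.+1 * avoid q d k.
have f0 k : (0 <= (f k)%:E)%E.
  by rewrite lee_fin !mulr_ge0 ?summand_ge0 ?one_sub_ge0 ?avoid_ge0.
have f0' k : (0 <= (f k.+1)%:E)%E by exact: f0.
have g0 k : (0 <= (g k)%:E)%E.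
  by rewrite lee_fin !mulr_ge0 ?summand_ge0 ?avoid_ge0.
transitivity (\sum_(k <oo) ((f k)%:E + (g k)%:E))%E.
  by apply: eq_eseriesr => k _; rewrite -EFinD /f /g /=; congr EFin; ring.
(* The factor [1 - q ^+ 0] kills [f 0], so [f] can be shifted by one index; [f k.+1 + g k] is then
   the left side of [summand_rec] times [avoid q d k]. *)
rewrite nneseriesD// nneseries_recl// [f 0](_ : _ = 0); last first.
  by rewrite /f expr0 subrr mulr0 mul0r.
rewrite add0e -(nneseries_addn 1)//.
under eq_eseriesr do rewrite addn1.
rewrite -nneseriesD//.
transitivity (\sum_(k <oo) (summand q (s + 1) k * avoid q d k)%:E)%E.
  apply: eq_eseriesr => k _; rewrite -EFinD -(summand_rec hq) /f /g /=; congr EFin;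
    ring.
by rewrite IH; have -> : s + 1 + d%:Z = s + d.+1%:Z by lia.
Qed.

Lemma series_lim (f : nat -> R) (x : R) :
  (\sum_(k <oo) (f k)%:E = x%:E)%E -> (forall k, 0 <= f k) ->
  limn (fun N => \sum_(0 <= k < N) f k) = x.
Proof.
move=> fx f0; apply/cvg_lim; first exact: Rhausdorff.
have : (fun N => \sum_(0 <= k < N) (f k)%:E)%E @ \oo --> x%:E.
  by rewrite -fx; apply: is_cvg_nneseries => k _ _; rewrite lee_fin.
move=> /fine_cvgP[_]; apply: cvg_trans; apply: near_eq_cvg; apply: nearW => N /=.
by rewrite sumEFin.
Qed.

Lemma summand_tail (m s : int) : s = - m ->
  \big[+%R/0]_(posp m <= k <oo)
     (q ^ ((k%:Z + 1) * (s + k%:Z)) / (qpoch q k * qpoch q (absz (s + k%:Z)))) =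
  limn (fun N => \sum_(0 <= k < N) summand q s k).
Proof.
move=> sm; congr (lim (_ @ \oo)); apply/funext => N.
have small k : (k < posp m)%N -> summand q s k = 0.
  by rewrite /posp /summand => km; rewrite ifF//; lia.
have large k : (posp m <= k)%N -> summand q s k =
    q ^ ((k%:Z + 1) * (s + k%:Z)) / (qpoch q k * qpoch q (absz (s + k%:Z))).
  by rewrite /posp /summand => km; rewrite ifT//; lia.
have [Nm|mN] := leqP N (posp m).
  rewrite big_geq// big_nat big1// => k /andP[_ kN].
  by rewrite small// (leq_trans kN).
rewrite [RHS](@big_cat_nat _ _ _ (posp m))//=; last exact: ltnW.
rewrite [X in _ = X + _]big_nat [X in _ = X + _]big1 ?add0r; last first.
  by move=> k /andP[_ /small].
by rewrite !big_nat; apply: eq_bigr => k /andP[/large-> _].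
Qed.

End AvoidSeries.

Lemma second_class_particle d (s : coupled_state d) (m : int) :
  eta_config s m < (xi_config s m)%:R <->
  xi_config s m /\ label (xi_config s) m \in codom (labels s).
Proof.
have Os := xi_config_Omega s; have Zs := labels_Zplus s.
rewrite /eta_config gtrBl; split.
  move=> h; have [j mj] : exists j, m = second_class_site s j.
    apply: contrapT => nj; move: h; rewrite big1 ?ltxx// => j _.
    by case: eqP => // e; exfalso; apply: nj; exists j.
  have [zs ls] := siteP Os (Zs.1 j).
  by rewrite mj /second_class_site ls; split=> //; exact: codom_f.
move=> [zm /codomP[j lj]];
  rewrite (bigD1 j)//= /second_class_site -lj site_label// eqxx.
by rewrite ltr_pwDl// sumr_ge0.
Qed.

Unset Implicit Arguments.
Set Strict Implicit.

Theorem proposition1p6 (R : realType) (q : R) (hq : 0 < q < 1)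
    (d : nat) (hd : (1 <= d)%N) (n : int)
    (c : R) (mu : probability config_space R)
    (hmu : is_product_blocking q c mu)
    (disp : measure_display) (T : measurableType disp) (P : probability T R)
    (Y : R -> T -> coupled_state d)
    (hY : markov_jump_process (@coupled_rate R q d) P Y)
    (hstat : stationary P Y)
    (hxi : forall (t : R) (A : set config), 0 <= t ->
       P [set w | A (xi_config (Y t w))] = (blocking_cond mu n A)%:E)
    (m : int) (t : R) (ht : 0 <= t) :
  P [set w | eta_config (Y t w) m < (xi_config (Y t w) m)%:R]
  = (qpoch_inf q *
     (\big[+%R/0]_(posp (m - n - 1) <= k <oo)
        (q ^ ((k%:Z + 1) * (n - m + k%:Z + 1)) /
         (qpoch q k * qpoch q (absz (n - m + k%:Z + 1))))
      - \big[+%R/0]_(posp (m - n - d%:Z - 1) <= k <oo)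
        (q ^ ((k%:Z + 1) * (n + d%:Z - m + k%:Z + 1)) /
         (qpoch q k * qpoch q (absz (n + d%:Z - m + k%:Z + 1))))))%:E.
Proof.
have hxi0 A := hxi 0 A (lexx 0).
have [K lawK] := law_product hq hmu hY hstat hxi0.
have law_off := law_off_level hY hxi0.
have mY0 := state_event_measurable hY.
have law := esum_state_law hY.
have L0 := state_law_ge0 P Y.
pose s := n - m + 1.
pose hit := [set x : coupled_state d |
  xi_config x m /\ label (xi_config x) m \in codom (labels x)].
pose miss := [set x : coupled_state d |
  xi_config x m /\ label (xi_config x) m \notin codom (labels x)].
have -> : [set w | eta_config (Y t w) m < (xi_config (Y t w) m)%:R] = Y t @^-1` hit.
  by apply/seteqP; split=> w /second_class_particle.
rewrite (hstat t hit ht).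
have by_label (B : nat -> set {ffun 'I_d -> int}) :
    \bigcup_k joint_event (Y 0) [set z | label z m = k%:Z /\ z m] (B k) =
    Y 0 @^-1` [set x | xi_config x m /\ B (absz (label (xi_config x) m)) (labels x)].
  apply/seteqP; split=> w.
    by move=> [k _ [/= [lk zm] Bk]]; split=> //; rewrite lk.
  move=> /= [zm Bk]; exists (absz (label (xi_config (Y 0 w)) m)) => //; split=> //=.
  by split=> //; have := label_ge0 (xi_config (Y 0 w)) m; lia.
have Pparticle : P (Y 0 @^-1` [set x | xi_config x m]) =
    (\sum_(k <oo) ((qpoch_inf q)%:E * (summand q s k)%:E))%E.
  have := summand_series hq mY0 L0 law lawK law_off (B := fun=> setT) (r := fun=> 1) m.
  rewrite by_label => /(_ (fun=> ler01)) e.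
  transitivity (P (Y 0 @^-1` [set x | xi_config x m /\ setT (labels x)])).
    by congr (P _); apply/seteqP; split=> w //= -[].
  rewrite e; last by move=> k; rewrite mul1e.
  by apply: eq_eseriesr => k _; rewrite mulr1.
have Pmiss : P (Y 0 @^-1` miss) =
    (\sum_(k <oo) ((qpoch_inf q)%:E * (summand q s k * avoid q d k)%:E))%E.
  have := summand_series hq mY0 L0 law lawK law_off
    (B := fun k => [set x | k%:Z \notin codom x]) (r := avoid q d) m (avoid_ge0 hq d).
  rewrite by_label => <-; last first.
    by move=> k; apply: avoid_mass => //;
      exact: (label_mass_lty hq L0 law lawK law_off).
  congr (P _); apply/seteqP; split=> w; rewrite /miss /=;
  by have -> : (absz (label (xi_config (Y 0 w)) m))%:Z = label (xi_config (Y 0 w)) m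
    by have := label_ge0 (xi_config (Y 0 w)) m; lia.
have Q0 : qpoch_inf q != 0 := qpoch_inf_neq0 hq mY0 L0 law lawK law_off.
have fin A : P (Y 0 @^-1` A) = (fine (P (Y 0 @^-1` A)))%:E.
  by rewrite fineK// fin_num_measure//; exact: mY0.
(* A probability is finite, so writing it as (q;q)_oo times a nonnegative series also makes the real
   series converge; dividing by the nonzero constant gives its value. *)
have sum_lim (x : int) A :
    P (Y 0 @^-1` A) = (\sum_(k <oo) ((qpoch_inf q)%:E * (summand q x k)%:E))%E ->
    limn (fun N => \sum_(0 <= k < N) summand q x k) = fine (P (Y 0 @^-1` A)) /
      qpoch_inf q.
  move=> e; apply: series_lim; last by move=> k; exact: summand_ge0.
  have := e; rewrite nneseriesZl; last by move=> k _; rewrite lee_fin summand_ge0.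
  rewrite fin => e'; rewrite mulrC EFinM e' muleA -EFinM mulVf// mul1e.
  by [].
have lim_particle := sum_lim _ _ Pparticle.
have lim_miss : limn (fun N => \sum_(0 <= k < N) summand q (s + d%:Z) k) =
    fine (P (Y 0 @^-1` miss)) / qpoch_inf q.
  apply: sum_lim; rewrite Pmiss !nneseriesZl ?(avoid_series hq)//.
    by move=> k _; rewrite lee_fin summand_ge0.
  by move=> k _; rewrite lee_fin mulr_ge0 ?summand_ge0 ?avoid_ge0.
have Phit : P (Y 0 @^-1` hit) =
    (fine (P (Y 0 @^-1` [set x | xi_config x m])) - fine (P (Y 0 @^-1` miss)))%:E.
  rewrite fin; congr EFin; apply/eqP; rewrite eq_sym subr_eq; apply/eqP.
  apply: EFin_inj; rewrite EFinD -!fin -measureU; last 3 first.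
  - exact: mY0.
  - exact: mY0.
  - by apply/seteqP; split=> // w [[_ h] [_ /negP]].
  congr (P _); apply/seteqP; split=> w /=; last by case=> -[].
  move=> xm.
  by case: (boolP (label (xi_config (Y 0 w)) m \in codom (labels (Y 0 w)))) => h;
    [left|right].
rewrite Phit; congr EFin.
(* [g] absorbs the order in which the statement writes the second index; both lower bounds are
   [posp] of minus the offset, which is [s] or [s + d]. *)
have tail (m' s' : int) (g : nat -> int) : s' = - m' -> (forall k, g k = s' + k%:Z) ->
    \big[+%R/0]_(posp m' <= k <oo)
      (q ^ ((k%:Z + 1) * g k) / (qpoch q k * qpoch q (absz (g k)))) =
    limn (fun N => \sum_(0 <= k < N) summand q s' k).
  move=> sm /funext -> ; exact: summand_tail.
rewrite (tail _ s (fun k => n - m + k%:Z + 1)); [|rewrite /s; lia|move=> k;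
  rewrite /s; lia].
rewrite (tail _ (s + d%:Z) (fun k => n + d%:Z - m + k%:Z + 1));
  [|rewrite /s; lia|move=> k; rewrite /s; lia].
by rewrite lim_particle lim_miss; field.
Qed.
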